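(* For every $\epsilon>0$ there exists a probabilistic algorithm $(L,F)$ such that, with $L$-probability at least $1-\epsilon$, the output $F(\alpha)$ is an infinite binary sequence $\omega=\omega_1\omega_2\dots$ with the following property: for every partial deterministic forecasting algorithm $f$ defined on all initial fragments $\omega^0,\omega^1,\dots$ of $\omega$, there exists a computable outcome-based selection rule $\delta$ defined on all these fragments such that $$\limsup_{n\to\infty}\left|\frac{1}{n}\sum_{i=1}^{n}\delta(\omega^{i-1})\,(\omega_i-f(\omega^{i-1}))\right|\ge \frac18 .$$
   Context: $\Omega$ is the set of infinite binary sequences, $\Xi$ the set of finite binary sequences, $\lambda$ the empty sequence; $\omega^n=\omega_1\dots\omega_n$ ($\omega^0=\lambda$); $x\sqsubseteq\omega$ means $x$ is a prefix of $\omega$; $\Gamma_x=\{\omega\in\Omega:x\sqsubseteq\omega\}$. $L$ is the uniform measure on $\Omega$, $L(\Gamma_x)=2^{-l(x)}$. A computable operation $F$ is given by a recursively enumerable set $\hat F\subseteq\Xi\times\Xi$ such that (i) $(x,\lambda)\in\hat F$ for all $x$, and (ii) if $(x,y),(x',y')\in\hat F$ and $x\sqsubseteq x'$ then $y\sqsubseteq y'$ or $y'\sqsubseteq y$; then $F(\omega)=\sup\{y:x\sqsubseteq\omega,\ (x,y)\in\hat F\}$ (supremum in the prefix order). A probabilistic algorithm is a pair $(L,F)$ with $F$ a computable operation; the probability of outputting a sequence in $A$ is $L\{\alpha:F(\alpha)\in A\}$. A partial deterministic forecasting algorithm is a partial recursive real function $f:\Xi\to[0,1]$, i.e. there is an algorithm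 which on input $x$ and rational $\kappa>0$ either outputs a rational within $\kappa$ of $f(x)$ or does not halt, with $f(x)$ defined iff it halts for every $\kappa$. An outcome-based selection rule is a function $\delta:\Xi\to\{0,1\}$; it is computable if it is partial recursive. *)

(* Defs.v *)
From Stdlib Require Import Reals Lra Lia List Arith Cantor.
Import ListNotations.
Open Scope R_scope.

Inductive code : Type :=
| CZero : code
| CSucc : code
| CProj : nat -> code
| CComp : code -> list code -> code
| CPrec : code -> code -> code
| CMu   : code -> code.

Inductive eval : code -> list nat -> nat -> Prop :=
| eZero xs : eval CZero xs 0
| eSucc xs : eval CSucc xs (S (hd 0%nat xs))
| eProj i xs : eval (CProj i) xs (nth i xs 0%nat)
| eComp f gs xs ys y : evals gs xs ys -> eval f ys y -> eval (CComp f gs) xs y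
| ePrec0 f g xs y : eval f xs y -> eval (CPrec f g) (0%nat :: xs) y
| ePrecS f g n xs r y :
    eval (CPrec f g) (n :: xs) r -> eval g (n :: r :: xs) y ->
    eval (CPrec f g) (S n :: xs) y
| eMu f xs n :
    eval f (n :: xs) 0%nat ->
    (forall m, (m < n)%nat -> exists k, eval f (m :: xs) (S k)) ->
    eval (CMu f) xs n
with evals : list code -> list nat -> list nat -> Prop :=
| esNil xs : evals [] xs []
| esCons g gs xs y ys : eval g xs y -> evals gs xs ys -> evals (g :: gs) xs (y :: ys).

Definition halts (c : code) (xs : list nat) : Prop := exists y, eval c xs y.

(* bijective encoding of finite binary sequences Xi = list bool into nat *)
Fixpoint code_bs (x : list bool) : nat :=
  match x with
  | [] => 0%nat
  | b :: l => (2 * code_bs l + 1 + (if b then 1 else 0))%nat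
  end.

Definition rat_pos_of_nat (n : nat) : R :=
  let (a, b) := Cantor.of_nat n in INR (S a) / INR (S b).

Definition rat_of_nat (z : nat) : R :=
  let (s, w) := Cantor.of_nat z in
  let (p, q) := Cantor.of_nat w in
  (if Nat.even s then 1 else -1) * (INR p / INR (S q)).

(* an infinite binary sequence omega = omega_1 omega_2 ... is a function
   om : nat -> bool with om k = omega_(k+1) *)
Definition seqb := nat -> bool.

Fixpoint prefix (om : seqb) (n : nat) : list bool :=
  match n with
  | O => []
  | S k => prefix om k ++ [om k]
  end.

Definition prefix_of (x : list bool) (om : seqb) : Prop := x = prefix om (length x).

Definition sub_bs (x y : list bool) : Prop := exists z, y = x ++ z.

Definition re_rel (Fh : list bool -> list bool -> Prop) : Prop :=
  exists c : code, forall x y, Fh x y <-> halts c [code_bs x; code_bs y].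

Definition computable_operation (Fh : list bool -> list bool -> Prop) : Prop :=
  re_rel Fh /\
  (forall x, Fh x []) /\
  (forall x y x' y', Fh x y -> Fh x' y' -> sub_bs x x' -> sub_bs y y' \/ sub_bs y' y).

(* F(alpha) = om, an infinite sequence: the supremum of all y with (x,y) in Fh,
   x a prefix of alpha, is the infinite sequence om *)
Definition op_output_inf (Fh : list bool -> list bool -> Prop) (alpha om : seqb) : Prop :=
  (forall x y, prefix_of x alpha -> Fh x y -> prefix_of y om) /\
  (forall n, exists x y, prefix_of x alpha /\ Fh x y /\ (n <= length y)%nat).

Definition outer_measure_le (A : seqb -> Prop) (e : R) : Prop :=
  forall eta, 0 < eta ->
  exists cov : nat -> option (list bool),
    (forall alpha, A alpha -> exists k x, cov k = Some x /\ prefix_of x alpha) /\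
    (forall N, sum_f_R0 (fun k => match cov k with
                                  | Some x => (/2) ^ length x
                                  | None => 0 end) N <= e + eta).

Definition pdfa (f : list bool -> option R) : Prop :=
  (forall x v, f x = Some v -> 0 <= v <= 1) /\
  exists c : code,
    (forall x, f x <> None <-> forall kn, halts c [code_bs x; kn]) /\
    (forall x v kn z, f x = Some v -> eval c [code_bs x; kn] z ->
        Rabs (rat_of_nat z - v) <= rat_pos_of_nat kn).

Definition computable_selection (d : list bool -> option bool) : Prop :=
  exists c : code, forall x y,
    eval c [code_bs x] y <-> exists b, d x = Some b /\ y = (if b then 1 else 0)%nat.

Definition limsup_ge (a : nat -> R) (c : R) : Prop :=
  forall eta, 0 < eta -> forall N, exists n, (N <= n)%nat /\ c - eta <= a n.

Definition b2R (b : bool) : R := if b then 1 else 0.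

Definition defeats_all_forecasters (om : seqb) : Prop :=
  forall (f : list bool -> option R) (fv : nat -> R),
    pdfa f -> (forall n, f (prefix om n) = Some (fv n)) ->
    exists (d : list bool -> option bool) (dv : nat -> bool),
      computable_selection d /\ (forall n, d (prefix om n) = Some (dv n)) /\
      (* a n = | 1/(n+1) * sum_{i=1}^{n+1} delta(om^{i-1}) (om_i - f(om^{i-1})) | *)
      limsup_ge (fun n => Rabs (/ INR (S n) *
                    sum_f_R0 (fun j => b2R (dv j) * (b2R (om j) - fv j)) n))
                (1/8).

(* Main.v *)
Require Import Defs.
From Stdlib Require Import Reals Lra Lia List Arith Cantor ClassicalEpsilon.
From Stdlib Require FinFun.
Import ListNotations.
Open Scope nat_scope.
Open Scope bool_scope.

(** The output is built in stages, the [k]-th of which extends a string [u] of length [start c k] to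
    one of length [start c (S k)]; stage [k] is devoted to the program [i = task_of k], and every [i]
    has infinitely many stages.  Normally the next block of [alpha] is copied.  With probability
    [2^-(i+c)], however, the algorithm holds at [u] until it finds an extension of [u] along which
    program [i], read as a forecaster, converges and has a large absolute error; then it outputs this
    extension.  The rule which runs the same search from [u], and selects the positions where the
    string found has the bit [b], is computable, and for [b = 0] or [b = 1] it has a large error on
    such a block, which is long enough to outweigh the past.

    Whatever a forecaster does, its absolute error on random bits is about 1/2 per bit, by Chebyshev's
    inequality.  Hence, if program [i] converges along the output, the search at each stage of [i]
    succeeds (the output itself is a witness if its block was copied).  A stage is used only
    if the searches at all earlier used stages of the same program have already terminated.
    So on each path at most one search of each program fails, and the measure lost by holding there is
    at most the sum of the [2^-(i+c)]; on the other hand, a program which converges along the output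
    has infinitely many used stages, and almost surely the algorithm holds at infinitely many of them. *)

(** * Total computable functions *)

(** A forecaster may be undefined off the output, so choosing each bit against its current value is
    not possible: waiting at an undefined value would end the run. Convergence along one whole block
    is semidecidable, so a search can look for it. The selection rule never consults the forecast.
    At a position selected for the bit [b] the outcome is [b], so the errors [b - f] have constant
    sign and do not cancel. The two rules share the absolute error of the block, so one of them gets
    at least half. Rounding forecasts to 1/6, 3/6 or 5/6 makes the search condition an inequality
    between integers, and the score of a fair bit has mean exactly 3 for every program. Rounding
    costs at most 1/6 per bit besides the approximation error, which is why the bound obtained is
    1/8 and not close to 1/4. Every natural number counts as a program of a universal machine, so no
    list of valid forecasters is involved. All probability estimates are explicit covers, obtained
    from nonnegative supermartingales that are specified at the ends of stages only; no
    measurability question arises. *)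

Definition Comp (k : nat) (F : list nat -> nat) : Prop :=
  exists c, forall v, length v = k -> eval c v (F v).

Lemma Comp_ext k F G : (forall v, length v = k -> F v = G v) -> Comp k F -> Comp k G.
Proof.
  intros H [c Hc]. exists c. intros v Hv. rewrite <- H by exact Hv. auto.
Qed.

Lemma Comp_proj k i : Comp k (fun v => nth i v 0).
Proof. exists (CProj i). intros v _. constructor. Qed.

Lemma Comp_subst m F k As :
  Comp m F -> Forall (Comp k) As -> length As = m ->
  Comp k (fun v => F (map (fun A => A v) As)).
Proof.
  intros [c Hc] HA Hm.
  assert (exists cs, forall v, length v = k -> evals cs v (map (fun A => A v) As)) as [cs Hcs].
  { clear Hm. induction HA as [|A As [d Hd] _ [ds Hds]].
    - exists []. constructor.
    - exists (d :: ds). intros v Hv. constructor; auto. }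
  exists (CComp c cs). intros v Hv. econstructor; [apply Hcs, Hv|].
  apply Hc. now rewrite length_map.
Qed.

Lemma Comp_succ k A : Comp k A -> Comp k (fun v => S (A v)).
Proof.
  intros [c Hc]. exists (CComp CSucc [c]). intros v Hv.
  econstructor; [repeat constructor; apply Hc, Hv|]. apply (eSucc [A v]).
Qed.

Lemma Comp_const k n : Comp k (fun _ => n).
Proof.
  induction n.
  - exists CZero. constructor.
  - now apply Comp_succ in IHn.
Qed.

(** These lemmas reduce closure under composition to computability on bare variables, where
    recursion and search can be applied. *)
Lemma Comp_fun1 f : Comp 1 (fun v => f (nth 0 v 0)) ->
  forall k A, Comp k A -> Comp k (fun v => f (A v)).
Proof. intros H k A HA. exact (Comp_subst 1 _ k [A] H ltac:(auto) eq_refl). Qed.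

Lemma Comp_fun2 f : Comp 2 (fun v => f (nth 0 v 0) (nth 1 v 0)) ->
  forall k A B, Comp k A -> Comp k B -> Comp k (fun v => f (A v) (B v)).
Proof. intros H k A B HA HB. exact (Comp_subst 2 _ k [A; B] H ltac:(auto) eq_refl). Qed.

Lemma Comp_fun3 f : Comp 3 (fun v => f (nth 0 v 0) (nth 1 v 0) (nth 2 v 0)) ->
  forall k A B C, Comp k A -> Comp k B -> Comp k C -> Comp k (fun v => f (A v) (B v) (C v)).
Proof. intros H k A B C HA HB HC. exact (Comp_subst 3 _ k [A; B; C] H ltac:(auto) eq_refl). Qed.

Lemma Comp_fun4 f : Comp 4 (fun v => f (nth 0 v 0) (nth 1 v 0) (nth 2 v 0) (nth 3 v 0)) ->
  forall k A B C D, Comp k A -> Comp k B -> Comp k C -> Comp k D ->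
  Comp k (fun v => f (A v) (B v) (C v) (D v)).
Proof.
  intros H k A B C D HA HB HC HD.
  exact (Comp_subst 4 _ k [A; B; C; D] H ltac:(repeat (constructor; auto)) eq_refl).
Qed.

Lemma evals_tail a v : evals (map CProj (seq (length a) (length v))) (a ++ v) v.
Proof.
  revert a. induction v as [|x v IH]; intro a; simpl; constructor.
  - pose proof (eProj (length a) (a ++ x :: v)) as H. now rewrite nth_middle in H.
  - specialize (IH (a ++ [x])).
    rewrite <- app_assoc, length_app, Nat.add_comm in IH. exact IH.
Qed.

Lemma Comp_weaken k A : Comp k A -> Comp (S k) (fun v => A (tl v)).
Proof.
  intros [c Hc]. exists (CComp c (map CProj (seq 1 k))). intros v Hv.
  destruct v as [|x v]; [discriminate|]. injection Hv as <-.
  econstructor; [apply (evals_tail [x])|]. now apply Hc.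
Qed.

(* A recursion step sees the counter and the previous value on top of the context; this hides the latter. *)
Lemma Comp_weaken_second k A : Comp (S k) A -> Comp (S (S k)) (fun w => A (nth 0 w 0 :: tl (tl w))).
Proof.
  intros [c Hc]. exists (CComp c (CProj 0 :: map CProj (seq 2 k))). intros w Hw.
  destruct w as [|n [|r v]]; try discriminate. injection Hw as <-.
  econstructor; [constructor; [constructor|apply (evals_tail [n; r])]|]. now apply Hc.
Qed.

Lemma Comp_rec k A G N : Comp k A -> Comp (S (S k)) G -> Comp k N ->
  Comp k (fun v => nat_rect (fun _ => nat) (A v) (fun n r => G (n :: r :: v)) (N v)).
Proof.
  intros [a Ha] [g Hg] [n Hn].
  exists (CComp (CPrec a g) (n :: map CProj (seq 0 k))). intros v Hv.
  econstructor.
  - constructor; [apply Hn, Hv|]. subst k. apply (evals_tail []).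
  - induction (N v) as [|m IH]; simpl.
    + constructor. auto.
    + econstructor; [exact IH|]. apply Hg. simpl. now rewrite Hv.
Qed.

Notation CompB k P := (Comp k (fun v => Nat.b2n (P v))).

Lemma Comp_least k (P : list nat -> bool) F : CompB (S k) P ->
  (forall v, length v = k -> P (F v :: v) = true /\ forall m, m < F v -> P (m :: v) = false) ->
  Comp k F.
Proof.
  intros HP HF.
  assert (Comp (S k) (fun v => 1 - Nat.b2n (P v))) as [c Hc].
  (* The code under [CMu] has to vanish exactly where [P] holds. The negation is a recursion on the
     truth value, since subtraction is itself obtained later. *)
  { apply Comp_ext with (F := fun v =>
      nat_rect (fun _ => nat) 1 (fun n r => nth 0 [0] 0) (Nat.b2n (P v))).
    - intros v _. destruct (P v); reflexivity.
    - apply (Comp_rec _ (fun _ => 1) (fun w => 0)); auto using Comp_const. }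
  exists (CMu c). intros v Hv. destruct (HF v Hv) as [H1 H2].
  assert (forall m, eval c (m :: v) (1 - Nat.b2n (P (m :: v)))) as H by (intro; apply Hc; simpl; auto).
  constructor.
  - specialize (H (F v)). now rewrite H1 in H.
  - intros m Hm. exists 0. specialize (H m). now rewrite (H2 m Hm) in H.
Qed.

(** Unbounded search for the value. Inverse functions, such as the projections of the pairing and
    halving, become computable in this way. *)
Lemma Comp_graph k (P : list nat -> bool) F : CompB (S k) P ->
  (forall v y, length v = k -> P (y :: v) = true <-> y = F v) -> Comp k F.
Proof.
  intros HP HF. apply (Comp_least k P); [exact HP|]. intros v Hv. split.
  - now apply HF.
  - intros m Hm. destruct (P (m :: v)) eqn:E; [|reflexivity]. apply HF in E; lia.
Qed.

Lemma Comp_if k P A B : CompB k P -> Comp k A -> Comp k B ->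
  Comp k (fun v => if P v then A v else B v : nat).
Proof.
  intros HP HA HB.
  apply Comp_ext with (F := fun v =>
    nat_rect (fun _ => nat) (B v) (fun n r => A (tl (tl (n :: r :: v)))) (Nat.b2n (P v))).
  - intros v _. destruct (P v); reflexivity.
  - apply (Comp_rec k B (fun w => A (tl (tl w)))); auto.
    now apply (Comp_weaken _ (fun w => A (tl w))), Comp_weaken.
Qed.

Lemma CompB_if k P Q R : CompB k P -> CompB k Q -> CompB k R ->
  CompB k (fun v => if P v then Q v else R v).
Proof.
  intros HP HQ HR. apply Comp_ext with (F := fun v => if P v then Nat.b2n (Q v) else Nat.b2n (R v)).
  - intros v _. now destruct (P v).
  - now apply Comp_if.
Qed.

Lemma CompB_not k P : CompB k P -> CompB k (fun v => negb (P v)).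
Proof. intro H. apply (CompB_if k P (fun _ => false) (fun _ => true)); auto; apply Comp_const. Qed.

Lemma CompB_and k P Q : CompB k P -> CompB k Q -> CompB k (fun v => P v && Q v).
Proof. intros H H'. apply (CompB_if k P Q (fun _ => false)); auto; apply Comp_const. Qed.

Lemma CompB_or k P Q : CompB k P -> CompB k Q -> CompB k (fun v => P v || Q v).
Proof. intros H H'. apply (CompB_if k P (fun _ => true) Q); auto; apply Comp_const. Qed.

Lemma CompB_implb k P Q : CompB k P -> CompB k Q -> CompB k (fun v => implb (P v) (Q v)).
Proof. intros H H'. apply (CompB_if k P Q (fun _ => true)); auto; apply Comp_const. Qed.

Lemma CompB_eqb k P Q : CompB k P -> CompB k Q -> CompB k (fun v => Bool.eqb (P v) (Q v)).
Proof.
  intros H H'. apply Comp_ext with (F := fun v => Nat.b2n (if P v then Q v else negb (Q v))).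
  - intros v _. now destruct (P v), (Q v).
  - auto using CompB_if, CompB_not.
Qed.

Lemma Comp_pred k A : Comp k A -> Comp k (fun v => pred (A v)).
Proof.
  revert k A. apply Comp_fun1.
  apply Comp_ext with (F := fun v =>
    nat_rect (fun _ => nat) 0 (fun n r => nth 0 (n :: r :: v) 0) (nth 0 v 0)).
  - intros v _. now destruct (nth 0 v 0).
  - apply (Comp_rec 1 (fun _ => 0) (fun w => nth 0 w 0)); auto using Comp_const, Comp_proj.
Qed.

Lemma Comp_add k A B : Comp k A -> Comp k B -> Comp k (fun v => A v + B v).
Proof.
  revert k A B. apply Comp_fun2.
  apply Comp_ext with (F := fun v =>
    nat_rect (fun _ => nat) (nth 1 v 0) (fun n r => S (nth 1 (n :: r :: v) 0)) (nth 0 v 0)).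
  - intros v _. simpl. induction (nth 0 v 0); simpl; auto.
  - apply (Comp_rec 2 _ (fun w => S (nth 1 w 0))); auto using Comp_succ, Comp_proj.
Qed.

Lemma Comp_sub k A B : Comp k A -> Comp k B -> Comp k (fun v => A v - B v).
Proof.
  revert k A B. apply Comp_fun2.
  apply Comp_ext with (F := fun v =>
    nat_rect (fun _ => nat) (nth 0 v 0) (fun n r => pred (nth 1 (n :: r :: v) 0)) (nth 1 v 0)).
  - intros v _. simpl. induction (nth 1 v 0); simpl; lia.
  - apply (Comp_rec 2 _ (fun w => pred (nth 1 w 0))); auto using Comp_pred, Comp_proj.
Qed.

Lemma Comp_mul k A B : Comp k A -> Comp k B -> Comp k (fun v => A v * B v).
Proof.
  revert k A B. apply Comp_fun2.
  apply Comp_ext with (F := fun v =>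
    nat_rect (fun _ => nat) 0
      (fun n r => nth 1 (n :: r :: v) 0 + nth 3 (n :: r :: v) 0) (nth 0 v 0)).
  - intros v _. simpl. induction (nth 0 v 0); simpl; lia.
  - apply (Comp_rec 2 (fun _ => 0) (fun w => nth 1 w 0 + nth 3 w 0));
      auto using Comp_add, Comp_proj, Comp_const.
Qed.

Lemma Comp_pow k A B : Comp k A -> Comp k B -> Comp k (fun v => A v ^ B v).
Proof.
  revert k A B. apply Comp_fun2.
  apply Comp_ext with (F := fun v =>
    nat_rect (fun _ => nat) 1
      (fun n r => nth 2 (n :: r :: v) 0 * nth 1 (n :: r :: v) 0) (nth 1 v 0)).
  - intros v _. simpl. induction (nth 1 v 0); simpl; auto.
  - apply (Comp_rec 2 (fun _ => 1) (fun w => nth 2 w 0 * nth 1 w 0));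
      auto using Comp_mul, Comp_proj, Comp_const.
Qed.

Lemma CompB_eq0 k A : Comp k A -> CompB k (fun v => A v =? 0).
Proof.
  intro H. apply Comp_ext with (F := fun v => 1 - A v).
  - intros v _. destruct (A v) as [|[|n]]; reflexivity.
  - apply (Comp_sub k (fun _ => 1)); auto using Comp_const.
Qed.

Lemma CompB_leb k A B : Comp k A -> Comp k B -> CompB k (fun v => A v <=? B v).
Proof.
  intros HA HB. apply Comp_ext with (F := fun v => Nat.b2n (A v - B v =? 0)).
  - intros v _. f_equal. apply Bool.eq_iff_eq_true. rewrite Nat.eqb_eq, Nat.leb_le. lia.
  - apply (CompB_eq0 k (fun v => A v - B v)). now apply Comp_sub.
Qed.

Lemma CompB_ltb k A B : Comp k A -> Comp k B -> CompB k (fun v => A v <? B v).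
Proof. intros HA HB. apply (CompB_leb k (fun v => S (A v))); auto using Comp_succ. Qed.

Lemma CompB_eqn k A B : Comp k A -> Comp k B -> CompB k (fun v => A v =? B v).
Proof.
  intros HA HB. apply Comp_ext with (F := fun v => Nat.b2n ((A v <=? B v) && (B v <=? A v))).
  - intros v _. f_equal. apply Bool.eq_iff_eq_true.
    rewrite Bool.andb_true_iff, Nat.eqb_eq, !Nat.leb_le. lia.
  - apply CompB_and; now apply CompB_leb.
Qed.

(** * Bounded quantifiers and sums *)

Definition ball (n : nat) (P : nat -> bool) : bool :=
  nat_rect (fun _ => bool) true (fun m r => r && P m) n.
Definition bex (n : nat) (P : nat -> bool) : bool := negb (ball n (fun m => negb (P m))).
Definition bsum (n : nat) (g : nat -> nat) : nat :=
  nat_rect (fun _ => nat) 0 (fun m r => r + g m) n.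

Lemma ball_iff n P : ball n P = true <-> forall m, m < n -> P m = true.
Proof.
  induction n as [|n IH]; simpl.
  - split; auto. lia.
  - unfold ball in IH. rewrite Bool.andb_true_iff, IH. split.
    + intros [H1 H2] m Hm. destruct (Nat.eq_dec m n); [now subst|apply H1; lia].
    + intro H. split; auto.
Qed.

Lemma bex_iff n P : bex n P = true <-> exists m, m < n /\ P m = true.
Proof.
  unfold bex. destruct (ball n _) eqn:E; simpl.
  - split; [discriminate|]. intros (m & Hm & H). rewrite ball_iff in E. specialize (E m Hm).
    rewrite H in E. discriminate.
  - split; auto. intros _. apply NNPP. intro H. apply Bool.not_true_iff_false in E. apply E.
    apply ball_iff. intros m Hm. destruct (P m) eqn:Em; auto. exfalso. eauto.
Qed.

Lemma ball_ext n P Q : (forall m, m < n -> P m = Q m) -> ball n P = ball n Q.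
Proof.
  intro H. apply Bool.eq_iff_eq_true. rewrite !ball_iff.
  split; intros H' m Hm; specialize (H m Hm); specialize (H' m Hm); congruence.
Qed.

Lemma CompB_ball k N (P : nat -> list nat -> bool) :
  Comp k N -> CompB (S k) (fun w => P (nth 0 w 0) (tl w)) ->
  CompB k (fun v => ball (N v) (fun m => P m v)).
Proof.
  intros HN HP. apply Comp_ext with (F := fun v => nat_rect (fun _ => nat) 1
    (fun n r => nth 1 (n :: r :: v) 0 * Nat.b2n (P (nth 0 (n :: r :: v) 0) (tl (tl (n :: r :: v))))) (N v)).
  - intros v _. simpl. induction (N v) as [|n IH]; simpl; auto.
    rewrite IH. fold (ball n (fun m => P m v)). now destruct (ball n _), (P n v).
  - apply (Comp_rec k (fun _ => 1)
      (fun w => nth 1 w 0 * Nat.b2n (P (nth 0 w 0) (tl (tl w))))); auto using Comp_const.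
    apply Comp_mul; [apply Comp_proj|].
    now apply (Comp_weaken_second k (fun w => Nat.b2n (P (nth 0 w 0) (tl w)))).
Qed.

Lemma CompB_bex k N (P : nat -> list nat -> bool) :
  Comp k N -> CompB (S k) (fun w => P (nth 0 w 0) (tl w)) ->
  CompB k (fun v => bex (N v) (fun m => P m v)).
Proof.
  intros HN HP. apply CompB_not, (CompB_ball k N (fun m v => negb (P m v))); auto.
  now apply CompB_not.
Qed.

Lemma Comp_bsum k N (g : nat -> list nat -> nat) :
  Comp k N -> Comp (S k) (fun w => g (nth 0 w 0) (tl w)) ->
  Comp k (fun v => bsum (N v) (fun m => g m v)).
Proof.
  intros HN Hg.
  apply (Comp_rec k (fun _ => 0)
      (fun w => nth 1 w 0 + g (nth 0 w 0) (tl (tl w)))); auto using Comp_const.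
  apply Comp_add; [apply Comp_proj|].
  now apply (Comp_weaken_second k (fun w => g (nth 0 w 0) (tl w))).
Qed.

(** Under a bounded quantifier the outer variables are reached through [tl]; moving it into the
    index turns them back into projections. *)
Lemma Comp_nth_tl k i (T : list nat -> list nat) :
  Comp k (fun v => nth (S i) (T v) 0) -> Comp k (fun v => nth i (tl (T v)) 0).
Proof.
  apply Comp_ext. intros v _. destruct (T v); [|reflexivity]. now destruct i.
Qed.

(** Hooks of [comp_step], redefined as further closure lemmas become available. *)
Ltac comp_pairs := fail.
Ltac comp_strings := fail.
Ltac comp_algorithm := fail.

Ltac comp_step :=
  match goal with
  | |- Comp _ (fun v => nth ?i v 0) => apply (Comp_proj _ i)
  | |- Comp _ (fun _ => ?n) => apply Comp_const
  | |- Comp ?k (fun v => nth ?i (tl (@?T v)) 0) => apply (Comp_nth_tl k i T)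
  | |- Comp ?k (fun v => S (@?A v)) => apply (Comp_succ k A)
  | |- Comp ?k (fun v => pred (@?A v)) => apply (Comp_pred k A)
  | |- Comp ?k (fun v => @?A v + @?B v) => apply (Comp_add k A B)
  | |- Comp ?k (fun v => @?A v - @?B v) => apply (Comp_sub k A B)
  | |- Comp ?k (fun v => @?A v * @?B v) => apply (Comp_mul k A B)
  | |- Comp ?k (fun v => @?A v ^ @?B v) => apply (Comp_pow k A B)
  | |- Comp ?k (fun v => if @?P v then @?A v else @?B v) => apply (Comp_if k P A B)
  | |- Comp ?k (fun v => Nat.b2n (if @?P v then @?A v else @?B v)) => apply (CompB_if k P A B)
  | |- Comp ?k (fun v => Nat.b2n (negb (@?P v))) => apply (CompB_not k P)
  | |- Comp ?k (fun v => Nat.b2n ((@?P v && @?Q v))) => apply (CompB_and k P Q)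
  | |- Comp ?k (fun v => Nat.b2n ((@?P v || @?Q v))) => apply (CompB_or k P Q)
  | |- Comp ?k (fun v => Nat.b2n (implb (@?P v) (@?Q v))) => apply (CompB_implb k P Q)
  | |- Comp ?k (fun v => Nat.b2n (Bool.eqb (@?P v) (@?Q v))) => apply (CompB_eqb k P Q)
  | |- Comp ?k (fun v => Nat.b2n (@?A v =? @?B v)) => apply (CompB_eqn k A B)
  | |- Comp ?k (fun v => Nat.b2n (@?A v <=? @?B v)) => apply (CompB_leb k A B)
  | |- Comp ?k (fun v => Nat.b2n (@?A v <? @?B v)) => apply (CompB_ltb k A B)
  | |- Comp ?k (fun v => Nat.b2n (ball (@?N v) (fun m => @?P v m))) =>
      apply (CompB_ball k N (fun m v => P v m))
  | |- Comp ?k (fun v => Nat.b2n (bex (@?N v) (fun m => @?P v m))) =>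
      apply (CompB_bex k N (fun m v => P v m))
  | |- Comp ?k (fun v => bsum (@?N v) (fun m => @?P v m)) =>
      apply (Comp_bsum k N (fun m v => P v m))
  | |- _ => first [comp_pairs | comp_strings | comp_algorithm]
  end; cbv beta.
Ltac comp := cbv beta; repeat comp_step.

(** * Pairs and lists coded by numbers *)

Lemma Comp_to_nat k A B : Comp k A -> Comp k B -> Comp k (fun v => to_nat (A v, B v)).
Proof.
  revert k A B. apply (Comp_fun2 (fun a b => to_nat (a, b))). unfold to_nat.
  apply Comp_add; [comp|].
  apply (Comp_rec 2 (fun _ => 0) (fun w => S (nth 0 w 0) + nth 1 w 0)
    (fun v => nth 1 v 0 + nth 0 v 0)); comp.
Qed.

Definition pfst (n : nat) : nat := fst (of_nat n).
Definition psnd (n : nat) : nat := snd (of_nat n).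

Lemma pfst_to_nat a b : pfst (to_nat (a, b)) = a.
Proof. unfold pfst. now rewrite cancel_of_to. Qed.

Lemma psnd_to_nat a b : psnd (to_nat (a, b)) = b.
Proof. unfold psnd. now rewrite cancel_of_to. Qed.

Lemma to_nat_pfst_psnd n : to_nat (pfst n, psnd n) = n.
Proof. unfold pfst, psnd. rewrite <- surjective_pairing. apply cancel_to_of. Qed.

Lemma pfst_le n : pfst n <= n.
Proof. pose proof (to_nat_non_decreasing (pfst n) (psnd n)) as H. rewrite to_nat_pfst_psnd in H. lia. Qed.

Lemma psnd_le n : psnd n <= n.
Proof. pose proof (to_nat_non_decreasing (pfst n) (psnd n)) as H. rewrite to_nat_pfst_psnd in H. lia. Qed.

Opaque to_nat of_nat.

(** A component never exceeds the code of its pair, so the other component can be sought below a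
    bound. *)
Lemma Comp_pfst k A : Comp k A -> Comp k (fun v => pfst (A v)).
Proof.
  revert k A. apply Comp_fun1.
  apply (Comp_graph 1 (fun v => bex (S (nth 1 v 0)) (fun b => to_nat (nth 0 v 0, b) =? nth 1 v 0))).
  - comp. apply (Comp_to_nat 3 (fun v => nth 0 (tl v) 0) (fun v => nth 0 v 0)); comp.
  - intros v y _. simpl. rewrite bex_iff. split.
    + intros (b & _ & H%Nat.eqb_eq). now rewrite <- H, pfst_to_nat.
    + intros ->. exists (psnd (nth 0 v 0)). rewrite to_nat_pfst_psnd, Nat.eqb_refl.
      pose proof (psnd_le (nth 0 v 0)). split; [lia|reflexivity].
Qed.

Lemma Comp_psnd k A : Comp k A -> Comp k (fun v => psnd (A v)).
Proof.
  revert k A. apply Comp_fun1.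
  apply (Comp_graph 1 (fun v => bex (S (nth 1 v 0)) (fun a => to_nat (a, nth 0 v 0) =? nth 1 v 0))).
  - comp. apply (Comp_to_nat 3 (fun v => nth 0 v 0) (fun v => nth 0 (tl v) 0)); comp.
  - intros v y _. simpl. rewrite bex_iff. split.
    + intros (b & _ & H%Nat.eqb_eq). now rewrite <- H, psnd_to_nat.
    + intros ->. exists (pfst (nth 0 v 0)). rewrite to_nat_pfst_psnd, Nat.eqb_refl.
      pose proof (pfst_le (nth 0 v 0)). split; [lia|reflexivity].
Qed.

Definition ncons (a l : nat) : nat := S (to_nat (a, l)).
(** Both [nhd 0] and [ntl 0] are 0, in agreement with [eval], which reads a missing argument as
    0. *)
Definition nhd (n : nat) : nat := pfst (pred n).
Definition ntl (n : nat) : nat := psnd (pred n).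
Definition nlist (l : list nat) : nat := fold_right ncons 0 l.
Definition nnth (i l : nat) : nat := nhd (nat_rect (fun _ => nat) l (fun _ r => ntl r) i).

Lemma nhd_ncons a l : nhd (ncons a l) = a.
Proof. apply pfst_to_nat. Qed.

Lemma ntl_ncons a l : ntl (ncons a l) = l.
Proof. apply psnd_to_nat. Qed.

Lemma ncons_eqb a l : (ncons a l =? 0) = false.
Proof. reflexivity. Qed.

Lemma nhd_nlist l : nhd (nlist l) = hd 0 l.
Proof. destruct l; [reflexivity|apply nhd_ncons]. Qed.

Lemma ntl_nlist l : ntl (nlist l) = nlist (tl l).
Proof. destruct l; [reflexivity|apply ntl_ncons]. Qed.

Lemma nnth_nlist i l : nnth i (nlist l) = nth i l 0.
Proof.
  unfold nnth.
  assert (nat_rect (fun _ => nat) (nlist l) (fun _ r => ntl r) i = nlist (skipn i l)) as ->.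
  { revert l. induction i as [|i IH]; intro l; simpl; [reflexivity|].
    rewrite IH, ntl_nlist. destruct l; simpl; [now rewrite skipn_nil|].
    change (tl (skipn i (n :: l))) with (skipn 1 (skipn i (n :: l))).
    now rewrite skipn_skipn, Nat.add_1_l. }
  rewrite nhd_nlist. revert l. induction i; intros [|]; simpl; auto.
Qed.

Lemma Comp_ncons k A B : Comp k A -> Comp k B -> Comp k (fun v => ncons (A v) (B v)).
Proof. intros. apply Comp_succ. now apply Comp_to_nat. Qed.

Lemma Comp_nhd k A : Comp k A -> Comp k (fun v => nhd (A v)).
Proof. intros. apply (Comp_pfst k (fun v => pred (A v))). now apply Comp_pred. Qed.

Lemma Comp_ntl k A : Comp k A -> Comp k (fun v => ntl (A v)).
Proof. intros. apply (Comp_psnd k (fun v => pred (A v))). now apply Comp_pred. Qed.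

Lemma Comp_nnth k A B : Comp k A -> Comp k B -> Comp k (fun v => nnth (A v) (B v)).
Proof.
  revert k A B. apply Comp_fun2. apply (Comp_nhd 2 (fun v => nat_rect _ _ _ _)).
  apply (Comp_rec 2 (fun v => nth 1 v 0) (fun w => ntl (nth 1 w 0)) (fun v => nth 0 v 0)); comp.
  apply (Comp_ntl 4 (fun w => nth 1 w 0)). comp.
Qed.

Ltac comp_pairs ::=
  match goal with
  | |- Comp ?k (fun v => to_nat (@?A v, @?B v)) => apply (Comp_to_nat k A B)
  | |- Comp ?k (fun v => pfst (@?A v)) => apply (Comp_pfst k A)
  | |- Comp ?k (fun v => psnd (@?A v)) => apply (Comp_psnd k A)
  | |- Comp ?k (fun v => ncons (@?A v) (@?B v)) => apply (Comp_ncons k A B)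
  | |- Comp ?k (fun v => nhd (@?A v)) => apply (Comp_nhd k A)
  | |- Comp ?k (fun v => ntl (@?A v)) => apply (Comp_ntl k A)
  | |- Comp ?k (fun v => nnth (@?A v) (@?B v)) => apply (Comp_nnth k A B)
  end.

Opaque ncons nhd ntl nnth.

(** * A universal machine *)

Fixpoint enc (c : code) : nat :=
  match c with
  | CZero => ncons 0 0
  | CSucc => ncons 1 0
  | CProj i => ncons 2 i
  | CComp f gs => ncons 3 (ncons (enc f)
      ((fix encs gs := match gs with [] => 0 | g :: gs => ncons (enc g) (encs gs) end) gs))
  | CPrec f g => ncons 4 (ncons (enc f) (enc g))
  | CMu f => ncons 5 (enc f)
  end.

(* A state pairs a stack of tasks with a stack of values; a task is a tag followed by its data. *)
Definition ev c xs := ncons 0 (ncons c xs).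
Definition evl gs xs := ncons 1 (ncons gs xs).
Definition applyT f := ncons 2 f.
Definition consT := ncons 3 0.
Definition precT g m xs := ncons 4 (ncons g (ncons m xs)).
Definition muT f m xs := ncons 5 (ncons f (ncons m xs)).

Definition step_ev (c xs R V : nat) : nat :=
  if nhd c =? 0 then to_nat (R, ncons 0 V)
  else if nhd c =? 1 then to_nat (R, ncons (S (nhd xs)) V)
  else if nhd c =? 2 then to_nat (R, ncons (nnth (ntl c) xs) V)
  else if nhd c =? 3 then to_nat (ncons (evl (ntl (ntl c)) xs) (ncons (applyT (nhd (ntl c))) R), V)
  else if nhd c =? 4 then
    if nhd xs =? 0 then to_nat (ncons (ev (nhd (ntl c)) (ntl xs)) R, V)
    else to_nat (ncons (ev c (ncons (pred (nhd xs)) (ntl xs)))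
                  (ncons (precT (ntl (ntl c)) (pred (nhd xs)) (ntl xs)) R), V)
  else to_nat (ncons (ev (ntl c) (ncons 0 xs)) (ncons (muT (ntl c) 0 xs) R), V).

(** Tags 2 to 5 are continuations: they resume when the value they wait for is on top of [V]. For
    tag 3 the coded tail is on top and the head below it, because the head was evaluated first. *)
Definition step_task (tag p R V : nat) : nat :=
  if tag =? 0 then step_ev (nhd p) (ntl p) R V
  else if tag =? 1 then
    if nhd p =? 0 then to_nat (R, ncons 0 V)
    else to_nat (ncons (ev (nhd (nhd p)) (ntl p)) (ncons (evl (ntl (nhd p)) (ntl p)) (ncons consT R)), V)
  else if tag =? 2 then to_nat (ncons (ev p (nhd V)) R, ntl V)
  else if tag =? 3 then to_nat (R, ncons (ncons (nhd (ntl V)) (nhd V)) (ntl (ntl V)))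
  else if tag =? 4 then
    to_nat (ncons (ev (nhd p) (ncons (nhd (ntl p)) (ncons (nhd V) (ntl (ntl p))))) R, ntl V)
  else if nhd V =? 0 then to_nat (R, ncons (nhd (ntl p)) (ntl V))
  else to_nat (ncons (ev (nhd p) (ncons (S (nhd (ntl p))) (ntl (ntl p))))
                (ncons (muT (nhd p) (S (nhd (ntl p))) (ntl (ntl p))) R), ntl V).

Definition step (s : nat) : nat :=
  if pfst s =? 0 then s
  else step_task (nhd (nhd (pfst s))) (ntl (nhd (pfst s))) (ntl (pfst s)) (psnd s).

Definition steps (s t : nat) : nat := nat_rect (fun _ => nat) s (fun _ r => step r) t.

Lemma Comp_step k A : Comp k A -> Comp k (fun v => step (A v)).
Proof.
  revert k A. apply Comp_fun1. unfold step, step_task.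
  assert (forall k A B C D, Comp k A -> Comp k B -> Comp k C -> Comp k D ->
    Comp k (fun v => step_ev (A v) (B v) (C v) (D v))) as H.
  { apply Comp_fun4. unfold step_ev, ev, evl, applyT, precT, muT. comp. }
  unfold ev, evl, consT, muT.
  apply Comp_if; [comp|comp|].
  apply Comp_if; [comp| |comp].
  apply (H 1 (fun v => nhd (ntl (nhd (pfst (nth 0 v 0))))) (fun v => ntl (ntl (nhd (pfst (nth 0 v 0)))))
    (fun v => ntl (pfst (nth 0 v 0))) (fun v => psnd (nth 0 v 0))); comp.
Qed.

Lemma Comp_steps k A B : Comp k A -> Comp k B -> Comp k (fun v => steps (A v) (B v)).
Proof.
  revert k A B. apply Comp_fun2.
  apply (Comp_rec 2 (fun v => nth 0 v 0) (fun w => step (nth 1 w 0)) (fun v => nth 1 v 0)); comp.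
  apply (Comp_step 4 (fun w => nth 1 w 0)). comp.
Qed.

Lemma steps_add s t t' : steps s (t + t') = steps (steps s t) t'.
Proof.
  induction t' as [|t' IH]; [now rewrite Nat.add_0_r|]. rewrite Nat.add_succ_r.
  exact (f_equal step IH).
Qed.

Lemma steps_S s t : steps s (S t) = steps (step s) t.
Proof. apply (steps_add s 1 t). Qed.

Lemma steps_halted V t : steps (to_nat (0, V)) t = to_nat (0, V).
Proof.
  induction t as [|t IH]; [reflexivity|].
  change (step (steps (to_nat (0, V)) t) = to_nat (0, V)). rewrite IH. unfold step.
  now rewrite pfst_to_nat.
Qed.

Definition reaches s s' := exists t, steps s t = s'.

Lemma reaches_refl s : reaches s s.
Proof. now exists 0. Qed.

Lemma reaches_trans s s' s'' : reaches s s' -> reaches s' s'' -> reaches s s''.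
Proof. intros [t <-] [t' <-]. exists (t + t'). apply steps_add. Qed.

Lemma reaches_step s s' : reaches (step s) s' -> reaches s s'.
Proof. intros [t <-]. exists (S t). apply steps_S. Qed.

(* The premise of [eMu] hides [eval] below an existential, where [Scheme] gives no induction hypothesis. *)
Section EvalInduction.

Variable P : code -> list nat -> nat -> Prop.
Variable Q : list code -> list nat -> list nat -> Prop.
Hypothesis HZero : forall xs, P CZero xs 0.
Hypothesis HSucc : forall xs, P CSucc xs (S (hd 0 xs)).
Hypothesis HProj : forall i xs, P (CProj i) xs (nth i xs 0).
Hypothesis HComp : forall f gs xs ys y, evals gs xs ys -> Q gs xs ys -> eval f ys y -> P f ys y ->
  P (CComp f gs) xs y.
Hypothesis HPrec0 : forall f g xs y, eval f xs y -> P f xs y -> P (CPrec f g) (0 :: xs) y.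
Hypothesis HPrecS : forall f g n xs r y, eval (CPrec f g) (n :: xs) r -> P (CPrec f g) (n :: xs) r ->
  eval g (n :: r :: xs) y -> P g (n :: r :: xs) y -> P (CPrec f g) (S n :: xs) y.
Hypothesis HMu : forall f xs n, eval f (n :: xs) 0 -> P f (n :: xs) 0 ->
  (forall m, m < n -> exists k, eval f (m :: xs) (S k) /\ P f (m :: xs) (S k)) -> P (CMu f) xs n.
Hypothesis HNil : forall xs, Q [] xs [].
Hypothesis HCons : forall g gs xs y ys, eval g xs y -> P g xs y -> evals gs xs ys -> Q gs xs ys ->
  Q (g :: gs) xs (y :: ys).

Fixpoint eval_strong_ind c xs y (h : eval c xs y) {struct h} : P c xs y
with evals_strong_ind gs xs ys (h : evals gs xs ys) {struct h} : Q gs xs ys.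
Proof.
  - destruct h as [| | |f gs xs ys y hs h|f g xs y h|f g n xs r y h h'|f xs n h hm].
    + apply HZero.
    + apply HSucc.
    + apply HProj.
    + exact (HComp f gs xs ys y hs (evals_strong_ind _ _ _ hs) h (eval_strong_ind _ _ _ h)).
    + exact (HPrec0 f g xs y h (eval_strong_ind _ _ _ h)).
    + exact (HPrecS f g n xs r y h (eval_strong_ind _ _ _ h) h' (eval_strong_ind _ _ _ h')).
    + apply (HMu f xs n h (eval_strong_ind _ _ _ h)). intros m Hm.
      destruct (hm m Hm) as [k Hk]. exists k. split; [exact Hk|exact (eval_strong_ind _ _ _ Hk)].
  - destruct h as [|g gs xs y ys h hs].
    + apply HNil.
    + exact (HCons g gs xs y ys h (eval_strong_ind _ _ _ h) hs (evals_strong_ind _ _ _ hs)).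
Qed.

Lemma eval_evals_ind :
  (forall c xs y, eval c xs y -> P c xs y) /\ (forall gs xs ys, evals gs xs ys -> Q gs xs ys).
Proof. split; [exact eval_strong_ind|exact evals_strong_ind]. Qed.

End EvalInduction.

Lemma eval_evals_fun :
  (forall c xs y, eval c xs y -> forall y', eval c xs y' -> y = y') /\
  (forall gs xs ys, evals gs xs ys -> forall ys', evals gs xs ys' -> ys = ys').
Proof.
  apply eval_evals_ind.
  - intros xs y' H. now inversion H.
  - intros xs y' H. now inversion H.
  - intros i xs y' H. now inversion H.
  - intros f gs xs ys y _ IHs _ IH y' H. inversion H; subst.
    assert (ys = ys0) as -> by auto. auto.
  - intros f g xs y _ IH y' H. inversion H; subst. auto.
  - intros f g n xs r y _ IHr _ IH y' H. inversion H; subst.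
    assert (r = r0) as -> by auto. auto.
  - intros f xs n _ IH0 IHm n' H. inversion H as [| | | | | |? ? ? H0 Hm]; subst.
    destruct (Nat.lt_trichotomy n n') as [Hlt|[E|Hlt]]; [|exact E|].
    + destruct (Hm n Hlt) as [k Hk]. now apply IH0 in Hk.
    + destruct (IHm n' Hlt) as (k & _ & Hk). now apply Hk in H0.
  - intros xs ys' H. now inversion H.
  - intros g gs xs y ys _ IHg _ IHgs ys' H. inversion H; subst. f_equal; auto.
Qed.

Ltac run := apply reaches_step; unfold step, step_task, step_ev, ev, evl, applyT, consT, precT, muT;
  repeat rewrite ?pfst_to_nat, ?psnd_to_nat, ?nhd_ncons, ?ntl_ncons, ?ncons_eqb, ?nhd_nlist,
    ?ntl_nlist, ?nnth_nlist; cbn [enc];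
  repeat rewrite ?nhd_ncons, ?ntl_ncons; cbn [hd tl pred Nat.eqb]; try fold evl.

Definition encs (gs : list code) : nat := fold_right (fun g => ncons (enc g)) 0 gs.

(** This links forecasters to machine indices: a terminating evaluation empties the task stack and
    leaves its value on top. As the machine is deterministic and stays put once it has no task,
    [halted] and [result] then report this value at all later times. *)
Lemma machine_complete :
  (forall c xs y, eval c xs y -> forall R V,
    reaches (to_nat (ncons (ev (enc c) (nlist xs)) R, V)) (to_nat (R, ncons y V))) /\
  (forall gs xs ys, evals gs xs ys -> forall R V,
    reaches (to_nat (ncons (evl (encs gs) (nlist xs)) R, V)) (to_nat (R, ncons (nlist ys) V))).
Proof.
  apply eval_evals_ind.
  - intros xs R V. run. apply reaches_refl.
  - intros xs R V. run. apply reaches_refl.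
  - intros i xs R V. run. apply reaches_refl.
  - intros f gs xs ys y _ IHs _ IHf R V.
    run. eapply reaches_trans; [apply IHs|]. run. apply IHf.
  - intros f g xs y _ IH R V. run. apply IH.
  - intros f g n xs r y _ IHr _ IHy R V. run.
    eapply reaches_trans; [apply IHr|]. run. apply (IHy R V).
  - intros f xs n _ IH0 IHm R V. run.
    (* Induction on the distance [d] from the current candidate [m] to the least zero [n]. *)
    assert (forall d m, m + d = n -> reaches
      (to_nat (ncons (ev (enc f) (nlist (m :: xs))) (ncons (muT (enc f) m (nlist xs)) R), V))
      (to_nat (R, ncons n V))) as H.
    { induction d as [|d IHd]; intros m Hm.
      - replace m with n by lia. eapply reaches_trans; [apply IH0|]. run. apply reaches_refl.
      - destruct (IHm m) as (k & _ & Hk); [lia|]. eapply reaches_trans; [apply Hk|].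
        run. apply (IHd (S m)). lia. }
    apply (H n 0). reflexivity.
  - intros xs R V. run. apply reaches_refl.
  - intros g gs xs y ys _ IHg _ IHgs R V. cbn [encs fold_right]. fold (encs gs). run.
    eapply reaches_trans; [apply IHg|]. eapply reaches_trans; [apply IHgs|]. run. apply reaches_refl.
Qed.

(** * Computing with binary strings *)

(** [code_bs] is bijective base-2 numeration with the digits 1 and 2, the first bit being the least
    significant digit. The number itself is enough fuel, since each step makes it smaller. *)
Fixpoint dec_fuel (f n : nat) : list bool :=
  match f, n with
  | S f, S m => Nat.odd m :: dec_fuel f (Nat.div2 m)
  | _, _ => []
  end.

Definition dec (n : nat) : list bool := dec_fuel n n.

Lemma code_dec n : code_bs (dec n) = n.
Proof.
  unfold dec. assert (forall f, n <= f -> code_bs (dec_fuel f n) = n) as H; [|auto].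
  induction n as [n IH] using lt_wf_ind. intros [|f] Hf; [simpl; lia|].
  destruct n as [|m]; [reflexivity|]. cbn [dec_fuel code_bs].
  pose proof (Nat.div2_odd m) as E. rewrite IH by lia. destruct (Nat.odd m); simpl in *; lia.
Qed.

Lemma code_bs_inj x y : code_bs x = code_bs y -> x = y.
Proof.
  revert y. induction x as [|a x IH]; intros [|b y]; cbn [code_bs]; try lia; [reflexivity|].
  intro H. destruct a, b; try lia; f_equal; apply IH; lia.
Qed.

Lemma dec_code x : dec (code_bs x) = x.
Proof. apply code_bs_inj, code_dec. Qed.

Definition bs_eqb (x y : list bool) : bool := code_bs x =? code_bs y.

Lemma bs_eqb_iff x y : bs_eqb x y = true <-> x = y.
Proof.
  unfold bs_eqb. rewrite Nat.eqb_eq. split; [apply code_bs_inj|now intros ->].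
Qed.

Lemma bs_eqb_refl x : bs_eqb x x = true.
Proof. now apply bs_eqb_iff. Qed.

Lemma list_eq_nth (x y : list bool) : length x = length y ->
  (forall i, i < length x -> nth i x false = nth i y false) -> x = y.
Proof. intros. now apply (nth_ext x y false false). Qed.

Notation CompL k X := (Comp k (fun v => code_bs (X v))).

Lemma CompL_dec k A : Comp k A -> CompL k (fun v => dec (A v)).
Proof. apply Comp_ext. intros v _. symmetry. apply code_dec. Qed.

Lemma CompB_bs_eqb k X Y : CompL k X -> CompL k Y -> CompB k (fun v => bs_eqb (X v) (Y v)).
Proof. intros. now apply (CompB_eqn k). Qed.

Lemma Comp_div2 k A : Comp k A -> Comp k (fun v => Nat.div2 (A v)).
Proof.
  revert k A. apply Comp_fun1. apply (Comp_graph 1 (fun v =>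
    (nth 1 v 0 =? 2 * nth 0 v 0) || (nth 1 v 0 =? S (2 * nth 0 v 0)))); [comp|].
  intros v y _. cbn [nth]. rewrite Bool.orb_true_iff, !Nat.eqb_eq.
  pose proof (Nat.div2_odd (nth 0 v 0)) as E. destruct (Nat.odd (nth 0 v 0)); simpl in E; lia.
Qed.

Lemma CompB_odd k A : Comp k A -> CompB k (fun v => Nat.odd (A v)).
Proof.
  revert k A. apply (Comp_fun1 (fun n => Nat.b2n (Nat.odd n))).
  apply Comp_ext with (F := fun v => nth 0 v 0 - 2 * Nat.div2 (nth 0 v 0)).
  - intros v _. pose proof (Nat.div2_odd (nth 0 v 0)). lia.
  - comp. apply (Comp_div2 1 (fun v => nth 0 v 0)). comp.
Qed.

(** Dropping the first bit takes the code [n] to half of [pred n] and fixes 0. The length is the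
    first iterate that is 0, and each bit is the parity of the predecessor of an iterate. *)
Definition code_skipn (m n : nat) : nat := nat_rect (fun _ => nat) n (fun _ r => Nat.div2 (pred r)) m.

Lemma code_bs_skipn m x : code_skipn m (code_bs x) = code_bs (skipn m x).
Proof.
  unfold code_skipn. induction m as [|m IH]; [reflexivity|]. simpl. rewrite IH.
  assert (forall l, Nat.div2 (pred (code_bs l)) = code_bs (tl l)) as ->.
  { intros [|b l]; [reflexivity|]. cbn [code_bs tl].
    destruct b.
    - replace (pred _) with (S (2 * code_bs l)) by lia. apply Nat.div2_succ_double.
    - replace (pred _) with (2 * code_bs l) by lia. apply Nat.div2_double. }
  f_equal. change (tl (skipn m x)) with (skipn 1 (skipn m x)).
  now rewrite skipn_skipn, Nat.add_1_l.
Qed.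

Lemma Comp_code_skipn k A B : Comp k A -> Comp k B -> Comp k (fun v => code_skipn (A v) (B v)).
Proof.
  revert k A B. apply Comp_fun2.
  apply (Comp_rec 2 (fun v => nth 1 v 0) (fun w => Nat.div2 (pred (nth 1 w 0))) (fun v => nth 0 v 0)); comp.
  apply (Comp_div2 4 (fun w => pred (nth 1 w 0))). comp.
Qed.

Lemma Comp_length k X : CompL k X -> Comp k (fun v => length (X v)).
Proof.
  intro H. apply Comp_ext with (F := fun v => length (dec (code_bs (X v)))).
  { intros v _. now rewrite dec_code. }
  revert H. apply (Comp_fun1 (fun n => length (dec n))).
  apply (Comp_least 1 (fun v => code_skipn (nth 0 v 0) (nth 1 v 0) =? 0)).
  - comp. apply (Comp_code_skipn 2 (fun v => nth 0 v 0) (fun v => nth 1 v 0)); comp.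
  - intros v _. cbn [nth]. set (n := nth 0 v 0).
    assert (forall m, code_skipn m n = code_bs (skipn m (dec n))) as E.
    { intro m. now rewrite <- code_bs_skipn, code_dec. }
    split; [now rewrite E, skipn_all|]. intros m Hm. rewrite E.
    pose proof (length_skipn m (dec n)) as L. destruct (skipn m (dec n)) as [|b l]; simpl in L; [lia|].
    apply Nat.eqb_neq. cbn [code_bs]. lia.
Qed.

Lemma CompB_nth k M X : Comp k M -> CompL k X -> CompB k (fun v => nth (M v) (X v) false).
Proof.
  intros HM HX. apply Comp_ext with (F := fun v => Nat.b2n
    (negb (code_skipn (M v) (code_bs (X v)) =? 0) && Nat.odd (pred (code_skipn (M v) (code_bs (X v)))))).
  - intros v _. f_equal. rewrite code_bs_skipn. generalize (M v) as m, (X v) as x.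
    induction m as [|m IH]; intros [|b x]; try reflexivity; [|apply IH].
    cbn [code_bs skipn nth]. replace (_ =? 0) with false by (symmetry; apply Nat.eqb_neq; lia).
    replace (pred _) with (Nat.b2n b + 2 * code_bs x) by (destruct b; simpl; lia).
    rewrite Nat.odd_add_mul_2. now destruct b.
  - pose proof (Comp_code_skipn k M (fun v => code_bs (X v)) HM HX) as H. apply CompB_and.
    + apply CompB_not. now apply CompB_eq0.
    + apply (CompB_odd k (fun v => pred _)). now apply Comp_pred.
Qed.

(** Instead of building a string by recursion, search for the code with the right length and
    bits. *)
Lemma CompL_graph k L (b : nat -> list nat -> bool) X :
  Comp k L -> CompB (S k) (fun w => b (nth 0 w 0) (tl w)) ->
  (forall v, length v = k -> length (X v) = L v /\ forall i, i < L v -> nth i (X v) false = b i v) ->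
  CompL k X.
Proof.
  intros HL Hb HX.
  apply (Comp_graph k (fun w => (length (dec (nth 0 w 0)) =? L (tl w)) &&
    ball (L (tl w)) (fun i => Bool.eqb (nth i (dec (nth 0 w 0)) false) (b i (tl w))))).
  - apply Comp_weaken in HL. apply CompB_and.
    + apply CompB_eqn; [|exact HL]. apply (Comp_length _ (fun w => dec (nth 0 w 0))), CompL_dec. comp.
    + apply (CompB_ball (S k) (fun w => L (tl w))
        (fun i w => Bool.eqb (nth i (dec (nth 0 w 0)) false) (b i (tl w)))); [exact HL|].
      apply CompB_eqb.
      * apply (CompB_nth _ (fun w => nth 0 w 0) (fun w => dec (nth 0 (tl w) 0))); [comp|].
        apply CompL_dec. comp.
      * now apply (Comp_weaken_second k (fun w => Nat.b2n (b (nth 0 w 0) (tl w)))).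
  - intros v y Hv. destruct (HX v Hv) as [H1 H2]. cbn [nth tl].
    rewrite Bool.andb_true_iff, Nat.eqb_eq, ball_iff. split.
    + intros [E1 E2]. rewrite <- (code_dec y). f_equal. apply list_eq_nth; [congruence|].
      intros i Hi. rewrite H2 by congruence. apply Bool.eqb_prop, E2. congruence.
    + intros ->. rewrite dec_code. split; [exact H1|]. intros i Hi. rewrite H2 by exact Hi.
      apply Bool.eqb_reflx.
Qed.

Lemma CompL_firstn k M X : Comp k M -> CompL k X -> CompL k (fun v => firstn (M v) (X v)).
Proof.
  intros HM HX.
  apply (CompL_graph k (fun v => if M v <=? length (X v) then M v else length (X v))
    (fun i v => nth i (X v) false)).
  - apply Comp_if; [apply CompB_leb| |]; auto using Comp_length.
  - apply CompB_nth; [comp|]. now apply (Comp_weaken k (fun v => code_bs (X v))).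
  - intros v _. rewrite length_firstn. split.
    + destruct (Nat.leb_spec (M v) (length (X v))); lia.
    + intros i Hi. rewrite nth_firstn. destruct (Nat.ltb_spec i (M v)); [reflexivity|].
      destruct (Nat.leb_spec (M v) (length (X v))); lia.
Qed.

Lemma CompL_snoc k X b : CompL k X -> CompB k b -> CompL k (fun v => X v ++ [b v]).
Proof.
  intros HX Hb.
  apply (CompL_graph k (fun v => S (length (X v)))
    (fun i v => if i <? length (X v) then nth i (X v) false else b v)).
  - apply (Comp_succ k (fun v => length (X v))). now apply Comp_length.
  - apply CompB_if.
    + apply CompB_ltb; [comp|]. apply (Comp_weaken k (fun v => length (X v))). now apply Comp_length.
    + apply CompB_nth; [comp|]. now apply (Comp_weaken k (fun v => code_bs (X v))).
    + now apply (Comp_weaken k (fun v => Nat.b2n (b v))).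
  - intros v _. rewrite length_app, Nat.add_1_r. split; [reflexivity|]. intros i Hi.
    destruct (Nat.ltb_spec i (length (X v))); [now apply app_nth1|].
    replace i with (length (X v)) by lia. apply nth_middle.
Qed.

Ltac comp_strings ::=
  match goal with
  | |- Comp ?k (fun v => steps (@?A v) (@?B v)) => apply (Comp_steps k A B)
  | |- Comp ?k (fun v => Nat.b2n (Nat.odd (@?A v))) => apply (CompB_odd k A)
  | |- Comp ?k (fun v => Nat.b2n (nth (@?A v) (@?X v) false)) => apply (CompB_nth k A X)
  | |- Comp ?k (fun v => Nat.b2n (bs_eqb (@?X v) (@?Y v))) => apply (CompB_bs_eqb k X Y)
  | |- Comp ?k (fun v => length (@?X v)) => apply (Comp_length k X)
  | |- Comp ?k (fun v => code_bs (dec (@?A v))) => apply (CompL_dec k A)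
  | |- Comp ?k (fun v => code_bs (firstn (@?A v) (@?X v))) => apply (CompL_firstn k A X)
  | |- Comp ?k (fun v => code_bs (@?X v ++ [@?b v])) => apply (CompL_snoc k X b)
  end.

(** * Recursively enumerable relations and partial recursive selection rules *)

(** As an equivalence this also controls divergence, on which recursively enumerable relations and
    partial rules depend. *)
Lemma eval_CMu_least k (P : list nat -> bool) c :
  (forall w, length w = S k -> eval c w (1 - Nat.b2n (P w))) ->
  forall v n, length v = k ->
  eval (CMu c) v n <-> P (n :: v) = true /\ forall m, m < n -> P (m :: v) = false.
Proof.
  intros Hc v n Hv.
  assert (forall m, eval c (m :: v) (1 - Nat.b2n (P (m :: v)))) as E by (intro; apply Hc; simpl; auto).
  split.
  - intro H. inversion H as [| | | | | |? ? ? H0 Hm]; subst. split.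
    + apply (proj1 eval_evals_fun _ _ _ (E n)) in H0. now destruct (P (n :: v)).
    + intros m Hlt. destruct (Hm m Hlt) as [j Hj]. apply (proj1 eval_evals_fun _ _ _ (E m)) in Hj.
      now destruct (P (m :: v)).
  - intros [H0 Hm]. constructor.
    + specialize (E n). now rewrite H0 in E.
    + intros m Hlt. exists 0. specialize (E m). now rewrite (Hm m Hlt) in E.
Qed.

Lemma CompB_code k P : CompB k P ->
  exists c, forall v, length v = k -> eval c v (1 - Nat.b2n (P v)).
Proof. intro H. apply (Comp_sub k (fun _ => 1) (fun v => Nat.b2n (P v))); [apply Comp_const|exact H]. Qed.

Lemma exists_least (P : nat -> bool) n : P n = true ->
  exists m, P m = true /\ forall q, q < m -> P q = false.
Proof.
  induction n as [n IH] using lt_wf_ind. intro H.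
  destruct (bex n P) eqn:E.
  - apply bex_iff in E. destruct E as (m & Hm & Pm). eauto.
  - exists n. split; [exact H|]. intros q Hq. apply Bool.not_true_iff_false. intro Hq'.
    apply Bool.not_true_iff_false in E. apply E, bex_iff. eauto.
Qed.

Lemma re_rel_exists (P : list bool -> list bool -> nat -> bool) :
  CompB 3 (fun v => P (dec (nth 1 v 0)) (dec (nth 2 v 0)) (nth 0 v 0)) ->
  re_rel (fun x y => exists t, P x y t = true).
Proof.
  intro H. apply CompB_code in H. destruct H as [c Hc]. exists (CMu c). intros x y.
  pose proof (eval_CMu_least 2 _ c Hc [code_bs x; code_bs y]) as E. cbn [nth] in E.
  rewrite !dec_code in E. split.
  - intros [t Ht]. apply exists_least in Ht. destruct Ht as (m & Hm). exists m. now apply E.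
  - intros [m Hm]. apply E in Hm; [|reflexivity]. exists m. apply Hm.
Qed.

Lemma selection_exists (Q G : list bool -> nat -> bool) :
  CompB 2 (fun v => Q (dec (nth 1 v 0)) (nth 0 v 0)) ->
  CompB 2 (fun v => G (dec (nth 1 v 0)) (nth 0 v 0)) ->
  exists d, computable_selection d /\
    forall x p, Q x p = true -> (forall q, q < p -> Q x q = false) -> d x = Some (G x p).
Proof.
  intros HQ [g Hg]. apply CompB_code in HQ. destruct HQ as [c Hc].
  set (e := CComp g [CMu c; CProj 0]).
  assert (forall x y, eval e [code_bs x] y <->
    exists p, Q x p = true /\ (forall q, q < p -> Q x q = false) /\ y = Nat.b2n (G x p)) as He.
  { intros x y. pose proof (eval_CMu_least 1 _ c Hc [code_bs x]) as E. cbn [nth] in E.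
    rewrite !dec_code in E.
    assert (forall p, eval g [p; code_bs x] (Nat.b2n (G x p))) as Eg.
    { intro p. specialize (Hg [p; code_bs x] eq_refl). cbn [nth] in Hg. now rewrite dec_code in Hg. }
    split.
    - intro H. inversion H as [| | |? ? ? ys ? Hs Hy| | |]; subst.
      inversion Hs as [|? ? ? p ? Hp Hs']; subst. inversion Hs' as [|? ? ? q ? Hq Hn]; subst.
      inversion Hn; subst. inversion Hq; subst. apply E in Hp; [|reflexivity].
      exists p. split; [apply Hp|]. split; [apply Hp|].
      symmetry. exact (proj1 eval_evals_fun _ _ _ (Eg p) _ Hy).
    - intros (p & H1 & H2 & ->). econstructor; [|apply Eg].
      constructor; [now apply E|]. constructor; [apply (eProj 0)|constructor]. }
  (* [computable_selection] asks for an equivalence, so [d] must be undefined exactly where the code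
     diverges; it is therefore read off from the evaluation of [e] by excluded middle. *)
  exists (fun x => match excluded_middle_informative (exists b, eval e [code_bs x] (Nat.b2n b)) with
    | left H => Some (proj1_sig (constructive_indefinite_description _ H))
    | right _ => None end).
  split.
  - exists e. intros x y. destruct excluded_middle_informative as [H|H].
    + destruct constructive_indefinite_description as [b Hb]. cbn [proj1_sig]. split.
      * intro Hy. exists b. split; [reflexivity|]. exact (proj1 eval_evals_fun _ _ _ Hy _ Hb).
      * intros (b' & [= <-] & ->). exact Hb.
    + split; [|now intros (b & ? & _)]. intro Hy. exfalso. apply H.
      pose proof Hy as Hy'. apply He in Hy'. destruct Hy' as (p & _ & _ & ->). eauto.
  - intros x p H1 H2. assert (eval e [code_bs x] (Nat.b2n (G x p))) as Ep by (apply He; eauto).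
    destruct excluded_middle_informative as [H|H]; [|exfalso; eauto].
    destruct constructive_indefinite_description as [b Hb]. cbn [proj1_sig]. f_equal.
    apply Nat.b2n_inj. exact (proj1 eval_evals_fun _ _ _ Hb _ Ep).
Qed.

(** * The algorithm *)

(* The ratio 256, the precision 1/100 and the threshold 11/4 for the average score (in sixths) of a
   block fit together so that half of the absolute error [(11/4 - 1)/6 - 1/100] per bit of a block,
   minus the length of the past, exceeds 1/8 of the total length.  Increasing [c] makes holding and
   exceptional blocks less likely. *)
Definition start (c k : nat) : nat := 256 ^ (k + c).
Definition block_len (c k : nat) : nat := start c (S k) - start c k.
Definition task_of (k : nat) : nat := pfst k.

(* The precision index of [1 / 100]. *)
Definition precision : nat := to_nat (0, 99).

Definition state (i n t : nat) : nat :=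
  steps (to_nat (ncons (ev i (ncons n (ncons precision 0))) 0, 0)) t.
Definition halted (i n t : nat) : bool := pfst (state i n t) =? 0.
Definition result (i n t : nat) : nat := nhd (psnd (state i n t)).

(* [third z / 6] is the midpoint of the third of [0, 1] in which the rational [rat_of_nat z] falls. *)
Definition third (z : nat) : nat :=
  if (negb (Nat.odd (pfst z)) && (S (psnd (psnd z)) <=? 3 * pfst (psnd z)))%bool
  then if 2 * S (psnd (psnd z)) <=? 3 * pfst (psnd z) then 5 else 3
  else 1.

(* [score a b / 6] is the distance between the forecast [a / 6] and the outcome [b]. *)
Definition score (a : nat) (b : bool) : nat := if b then 6 - a else a.

(* The number [p] serves both as a string and as a time bound. *)
Definition ok (c i k : nat) (u : list bool) (p : nat) : bool :=
  (start c (S k) <=? length (dec p)) && bs_eqb (firstn (start c k) (dec p)) u &&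
  ball (block_len c k) (fun m => halted i (code_bs (firstn (start c k + m) (dec p))) p) &&
  (11 * block_len c k <=? 4 * bsum (block_len c k) (fun m =>
     score (third (result i (code_bs (firstn (start c k + m) (dec p))) p))
           (nth (start c k + m) (dec p) false))).

(** Whether a stage is attempted depends on which earlier stages were, hence the list [a] of earlier
    decisions and course-of-values recursion in [atts]. The bound [S k] on the searches makes the
    decision computable; a search that succeeds late only delays the next attempt. *)
Definition unblocked (c : nat) (u : list bool) (k : nat) (a : list bool) : bool :=
  ball k (fun j => implb ((task_of j =? task_of k) && nth j a false)
                     (bex (S k) (fun p => ok c (task_of j) j (firstn (start c j) u) p))).

Definition atts (c : nat) (u : list bool) (k : nat) : list bool :=
  nat_rect (fun _ => list bool) [] (fun j a => a ++ [unblocked c u j a]) k.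

Definition att (c : nat) (u : list bool) (k : nat) : bool := unblocked c u k (atts c u k).

(** The bits tested belong to the block that is copied when the test fails, so copied blocks are not
    uniformly distributed. For this reason [deviates] refers to every block of the input, held or
    copied. *)
Definition hold (c k : nat) (x : list bool) : bool :=
  ball (task_of k + c) (fun m => nth (start c k + m) x false).

Definition leastok (c i k : nat) (u : list bool) (p : nat) : bool :=
  ok c i k u p && ball p (fun q => negb (ok c i k u q)).

(** Outputs are verified, not produced: a candidate [y] is given, so every decision of a stage can
    be computed from its prefixes, and only the search for [p] has to be cut off at [t]. In
    [output_check] the same [t] bounds the number of stages and the code of the candidate. *)
Definition stage_check (c : nat) (x y : list bool) (j t : nat) : bool :=
  if att c (firstn (start c j) y) j && hold c j x
  then bex t (fun p => leastok c (task_of j) j (firstn (start c j) y) p &&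
                       bs_eqb (firstn (start c (S j)) (dec p)) (firstn (start c (S j)) y))
  else ball (block_len c j) (fun m => Bool.eqb (nth (start c j + m) y false) (nth (start c j + m) x false)).

Definition run_check (c : nat) (x y : list bool) (k t : nat) : bool :=
  (start c k <=? length x) && (length y =? start c k) && bs_eqb (firstn (start c 0) y) (firstn (start c 0) x) &&
  ball k (fun j => stage_check c x y j t).

Definition output_check (c : nat) (x y : list bool) (t : nat) : bool :=
  bs_eqb y [] || bex t (fun k => bex t (fun n => run_check c x (dec n) k t &&
                                               bs_eqb (firstn (length y) (dec n)) y)).

Definition Fhat (c : nat) (x y : list bool) : Prop := exists t, output_check c x y t = true.

(** * Computability of the checks *)

Lemma Comp_start c k A : Comp k A -> Comp k (fun v => start c (A v)).
Proof. intro H. unfold start. comp. exact H. Qed.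

Lemma Comp_block_len c k A : Comp k A -> Comp k (fun v => block_len c (A v)).
Proof.
  intro H. apply (Comp_sub k (fun v => start c (S (A v))) (fun v => start c (A v))).
  - apply (Comp_start c k (fun v => S (A v))). now apply Comp_succ.
  - now apply Comp_start.
Qed.

Lemma start_S c k : start c (S k) = 256 * start c k.
Proof. unfold start. now rewrite Nat.add_succ_l, Nat.pow_succ_r'. Qed.

Lemma start_gt c k : k + c < start c k.
Proof. unfold start. apply Nat.pow_gt_lin_r. lia. Qed.

Lemma block_len_eq c k : block_len c k = 255 * start c k.
Proof. unfold block_len. rewrite start_S. lia. Qed.

Lemma start_0 c : start c 0 = 256 ^ c.
Proof. reflexivity. Qed.

Opaque start block_len.

Lemma Comp_state k A B C : Comp k A -> Comp k B -> Comp k C ->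
  Comp k (fun v => state (A v) (B v) (C v)).
Proof. revert k A B C. apply Comp_fun3. unfold state, ev. comp. Qed.

Lemma Comp_third k A : Comp k A -> Comp k (fun v => third (A v)).
Proof. revert k A. apply Comp_fun1. unfold third. comp. Qed.

Ltac comp_algorithm ::=
  match goal with
  | |- Comp ?k (fun v => start ?c (@?A v)) => apply (Comp_start c k A)
  | |- Comp ?k (fun v => block_len ?c (@?A v)) => apply (Comp_block_len c k A)
  | |- Comp ?k (fun v => state (@?A v) (@?B v) (@?C v)) => apply (Comp_state k A B C)
  | |- Comp ?k (fun v => third (@?A v)) => apply (Comp_third k A)
  end.

(** Replacing [X v] by [dec (code_bs (X v))] makes the predicate a function of four numbers, to
    which [Comp_fun4] applies. The following lemmas treat their string arguments in the same way. *)
Lemma CompB_ok c k A B X D : Comp k A -> Comp k B -> CompL k X -> Comp k D ->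
  CompB k (fun v => ok c (A v) (B v) (X v) (D v)).
Proof.
  intros HA HB HX HD.
  apply Comp_ext with (F := fun v => Nat.b2n (ok c (A v) (B v) (dec (code_bs (X v))) (D v))).
  { intros v _. now rewrite dec_code. }
  apply (fun H => Comp_fun4 (fun a b x d => Nat.b2n (ok c a b (dec x) d)) H
    k A B (fun v => code_bs (X v)) D HA HB HX HD).
  unfold ok, halted, result, score. comp.
Qed.

Lemma CompB_unblocked c k X A Y : CompL k X -> Comp k A -> CompL k Y ->
  CompB k (fun v => unblocked c (X v) (A v) (Y v)).
Proof.
  intros HX HA HY.
  apply Comp_ext with (F := fun v =>
    Nat.b2n (unblocked c (dec (code_bs (X v))) (A v) (dec (code_bs (Y v))))).
  { intros v _. now rewrite !dec_code. }
  apply (fun H => Comp_fun3 (fun x a y => Nat.b2n (unblocked c (dec x) a (dec y))) H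
    k (fun v => code_bs (X v)) A (fun v => code_bs (Y v)) HX HA HY).
  unfold unblocked, task_of. comp. apply (CompB_ok c 5 (fun v => pfst (nth 0 (tl v) 0))
    (fun v => nth 0 (tl v) 0) (fun v => firstn (start c (nth 0 (tl v) 0)) (dec (nth 0 (tl (tl v)) 0)))
    (fun v => nth 0 v 0)); comp.
Qed.

Lemma CompL_atts c k X A : CompL k X -> Comp k A -> CompL k (fun v => atts c (X v) (A v)).
Proof.
  intros HX HA.
  apply Comp_ext with (F := fun v => code_bs (atts c (dec (code_bs (X v))) (A v))).
  { intros v _. now rewrite dec_code. }
  apply (fun H => Comp_fun2 (fun x a => code_bs (atts c (dec x) a)) H
    k (fun v => code_bs (X v)) A HX HA).
  apply Comp_ext with (F := fun v => nat_rect (fun _ => nat) 0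
    (fun j r => code_bs (dec r ++ [unblocked c (dec (nth 0 v 0)) j (dec r)])) (nth 1 v 0)).
  - intros v _. induction (nth 1 v 0) as [|n IH]; [reflexivity|]. simpl. rewrite IH.
    now rewrite dec_code.
  - apply (Comp_rec 2 (fun _ => 0) (fun w => code_bs (dec (nth 1 w 0) ++
      [unblocked c (dec (nth 2 w 0)) (nth 0 w 0) (dec (nth 1 w 0))])) (fun v => nth 1 v 0)); comp.
    apply (CompB_unblocked c 4 (fun w => dec (nth 2 w 0)) (fun w => nth 0 w 0)
      (fun w => dec (nth 1 w 0))); comp.
Qed.

Lemma CompB_att c k X A : CompL k X -> Comp k A -> CompB k (fun v => att c (X v) (A v)).
Proof.
  intros HX HA. apply (CompB_unblocked c k X A (fun v => atts c (X v) (A v))); auto.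
  now apply CompL_atts.
Qed.

Lemma CompB_leastok c k A B X D : Comp k A -> Comp k B -> CompL k X -> Comp k D ->
  CompB k (fun v => leastok c (A v) (B v) (X v) (D v)).
Proof.
  intros HA HB HX HD. apply CompB_and; [now apply CompB_ok|].
  apply (CompB_ball k D (fun q v => negb (ok c (A v) (B v) (X v) q))); [exact HD|].
  apply CompB_not. apply CompB_ok; [| | |comp].
  - now apply (Comp_weaken k A).
  - now apply (Comp_weaken k B).
  - now apply (Comp_weaken k (fun v => code_bs (X v))).
Qed.

Lemma CompB_stage_check c k X Y A B : CompL k X -> CompL k Y -> Comp k A -> Comp k B ->
  CompB k (fun v => stage_check c (X v) (Y v) (A v) (B v)).
Proof.
  intros HX HY HA HB.
  apply Comp_ext with (F := fun v =>
    Nat.b2n (stage_check c (dec (code_bs (X v))) (dec (code_bs (Y v))) (A v) (B v))).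
  { intros v _. now rewrite !dec_code. }
  apply (fun H => Comp_fun4 (fun x y j t => Nat.b2n (stage_check c (dec x) (dec y) j t)) H
    k (fun v => code_bs (X v)) (fun v => code_bs (Y v)) A B HX HY HA HB).
  unfold stage_check, hold, task_of. comp.
  - apply (CompB_att c 4 (fun v => firstn (start c (nth 2 v 0)) (dec (nth 1 v 0))) (fun v => nth 2 v 0)); comp.
  - apply (CompB_leastok c 5 (fun v => pfst (nth 2 (tl v) 0)) (fun v => nth 2 (tl v) 0)
      (fun v => firstn (start c (nth 2 (tl v) 0)) (dec (nth 1 (tl v) 0))) (fun v => nth 0 v 0)); comp.
Qed.

Lemma Fhat_re c : re_rel (Fhat c).
Proof.
  apply re_rel_exists. unfold output_check, run_check. comp.
  apply (CompB_stage_check c 6 (fun v => dec (nth 1 (tl (tl (tl v))) 0)) (fun v => dec (nth 0 (tl v) 0))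
    (fun v => nth 0 v 0) (fun v => nth 0 (tl (tl (tl v))) 0)); comp.
Qed.

(** * Runs and the operation they define *)

Lemma start_block_len c k : start c (S k) = start c k + block_len c k.
Proof. rewrite block_len_eq, start_S. lia. Qed.

Lemma start_mono c j k : j <= k -> start c j <= start c k.
Proof. induction 1; [lia|]. rewrite start_S. lia. Qed.

Lemma hold_room c k : task_of k + c <= block_len c k.
Proof. pose proof (start_gt c k). rewrite block_len_eq. pose proof (pfst_le k). unfold task_of. lia. Qed.

Definition block (c k : nat) (x : list bool) : list bool := firstn (block_len c k) (skipn (start c k) x).

(** A relation, because the search of a held stage may fail; then no [y] exists and the run ends at
    [u]. *)
Definition Stage (c : nat) (x : list bool) (k : nat) (u y : list bool) : Prop :=
  if att c u k && hold c k x
  then exists p, leastok c (task_of k) k u p = true /\ y = firstn (start c (S k)) (dec p)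
  else y = u ++ block c k x.

Fixpoint Run (c : nat) (x : list bool) (k : nat) (y : list bool) : Prop :=
  match k with
  | 0 => y = firstn (start c 0) x
  | S k => exists u, Run c x k u /\ Stage c x k u y
  end.

Lemma ok_spec c i k u p : ok c i k u p = true ->
  start c (S k) <= length (dec p) /\ firstn (start c k) (dec p) = u.
Proof.
  unfold ok. rewrite !Bool.andb_true_iff, Nat.leb_le, bs_eqb_iff. tauto.
Qed.

Lemma leastok_iff c i k u p : leastok c i k u p = true <->
  ok c i k u p = true /\ forall q, q < p -> ok c i k u q = false.
Proof.
  unfold leastok. rewrite Bool.andb_true_iff, ball_iff.
  split; intros [H1 H2]; split; auto; intros q Hq; specialize (H2 q Hq);
    now destruct (ok c i k u q).
Qed.

Lemma leastok_fun c i k u p q : leastok c i k u p = true -> leastok c i k u q = true -> p = q.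
Proof.
  rewrite !leastok_iff. intros [H1 H2] [H3 H4].
  destruct (Nat.lt_trichotomy p q) as [H|[H|H]]; auto.
  - rewrite (H4 p H) in H1. discriminate.
  - rewrite (H2 q H) in H3. discriminate.
Qed.

Lemma length_block c k x : start c (S k) <= length x -> length (block c k x) = block_len c k.
Proof.
  intro H. unfold block. rewrite length_firstn, length_skipn. rewrite start_block_len in H. lia.
Qed.

Lemma nth_block c k x m : m < block_len c k -> nth m (block c k x) false = nth (start c k + m) x false.
Proof.
  intro H. unfold block. rewrite nth_firstn. apply Nat.ltb_lt in H. rewrite H. apply nth_skipn.
Qed.

Lemma Stage_spec c x k u y : start c (S k) <= length x -> length u = start c k -> Stage c x k u y ->
  length y = start c (S k) /\ firstn (start c k) y = u.
Proof.
  intros Hx Hu. unfold Stage. pose proof (start_mono c k (S k)).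
  destruct (att c u k && hold c k x).
  - intros (p & Hp & ->). apply leastok_iff in Hp. destruct Hp as [Hp _]. apply ok_spec in Hp.
    rewrite length_firstn, firstn_firstn. rewrite (Nat.min_l (start c k)) by lia. split; [lia|tauto].
  - intros ->. rewrite length_app, length_block by exact Hx. rewrite start_block_len. split; [lia|].
    rewrite <- Hu, firstn_app, Nat.sub_diag, firstn_all. apply app_nil_r.
Qed.

Lemma Run_length c x k y : start c k <= length x -> Run c x k y -> length y = start c k.
Proof.
  revert y. induction k as [|k IH]; intros y Hx.
  - intros ->. rewrite length_firstn. lia.
  - intros (u & Hu & Hy). pose proof (start_mono c k (S k)). apply IH in Hu; [|lia].
    now apply (Stage_spec c x k u y).
Qed.

Lemma hold_ext c k x x' : firstn (start c (S k)) x = firstn (start c (S k)) x' -> hold c k x = hold c k x'.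
Proof.
  intro H. unfold hold. apply ball_ext. intros m Hm.
  pose proof (hold_room c k). pose proof (start_block_len c k).
  apply (f_equal (fun l => nth (start c k + m) l false)) in H. rewrite !nth_firstn in H.
  destruct (Nat.ltb_spec (start c k + m) (start c (S k))); [exact H|lia].
Qed.

Lemma firstn_le {T} (x x' : list T) m n : m <= n -> firstn n x = firstn n x' -> firstn m x = firstn m x'.
Proof.
  intros H E. apply (f_equal (firstn m)) in E. rewrite !firstn_firstn, Nat.min_l in E by exact H.
  exact E.
Qed.

Lemma block_ext c k x x' : firstn (start c (S k)) x = firstn (start c (S k)) x' -> block c k x = block c k x'.
Proof.
  intro H. unfold block. rewrite !firstn_skipn_comm. rewrite start_block_len in H. now rewrite H.
Qed.

Lemma Run_ext c x x' k y : firstn (start c k) x = firstn (start c k) x' -> Run c x k y -> Run c x' k y.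
Proof.
  revert y. induction k as [|k IH]; intros y E; simpl.
  - congruence.
  - intros (u & Hu & Hy). exists u. split.
    + apply IH; [|exact Hu]. apply (firstn_le _ _ _ (start c (S k))); [apply start_mono; lia|exact E].
    + unfold Stage in *. now rewrite <- (hold_ext c k x x' E), <- (block_ext c k x x' E).
Qed.

Lemma Run_fun c x k y y' : Run c x k y -> Run c x k y' -> y = y'.
Proof.
  revert y y'. induction k as [|k IH]; intros y y'; simpl.
  - congruence.
  - intros (u & Hu & Hy) (u' & Hu' & Hy'). rewrite <- (IH u u' Hu Hu') in Hy'. unfold Stage in *.
    destruct (att c u k && hold c k x); [|congruence].
    destruct Hy as (p & Hp & ->), Hy' as (q & Hq & ->). now rewrite (leastok_fun _ _ _ _ _ _ Hp Hq).
Qed.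

Lemma Run_firstn c x j k y : j <= k -> start c k <= length x -> Run c x k y -> Run c x j (firstn (start c j) y).
Proof.
  intro H. revert y. induction H as [|k H IH]; intros y Hx Hy.
  - apply Run_length in Hy as L; [|exact Hx]. now rewrite <- L, firstn_all.
  - pose proof (start_mono c j k H). pose proof (start_mono c k (S k)).
    destruct Hy as (u & Hu & Hs). apply Stage_spec in Hs; [|exact Hx|apply (Run_length c x k u); [lia|exact Hu]].
    destruct Hs as [_ E]. rewrite <- E in Hu. apply IH in Hu; [|lia].
    rewrite firstn_firstn, Nat.min_l in Hu by lia. exact Hu.
Qed.

Lemma Run_step c x j k y : j < k -> start c k <= length x -> Run c x k y ->
  Stage c x j (firstn (start c j) y) (firstn (start c (S j)) y).
Proof.
  intros H Hx Hy. pose proof (start_mono c j (S j)). pose proof (start_mono c (S j) k H).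
  destruct (Run_firstn c x (S j) k y H Hx Hy) as (u & Hu & Hs).
  apply Run_length in Hu as L; [|lia]. pose proof (Stage_spec c x j u _ ltac:(lia) L Hs) as [_ E].
  rewrite firstn_firstn, Nat.min_l in E by lia. now rewrite E.
Qed.

Lemma firstn_add {T} m n (x : list T) : firstn (m + n) x = firstn m x ++ firstn n (skipn m x).
Proof. revert x. induction m; intros [|a x]; simpl; auto using firstn_nil. now rewrite IHm. Qed.

Lemma stage_check_iff c x y j : start c (S j) <= length x -> start c (S j) <= length y ->
  Stage c x j (firstn (start c j) y) (firstn (start c (S j)) y) <->
  exists t, forall t', t <= t' -> stage_check c x y j t' = true.
Proof.
  intros Hx Hy. unfold Stage, stage_check.
  destruct (att c (firstn (start c j) y) j && hold c j x).
  - split.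
    + intros (p & Hp & E). exists (S p). intros t' Ht'. apply bex_iff. exists p.
      rewrite Hp, E. split; [lia|]. apply bs_eqb_refl.
    + intros [t Ht]. specialize (Ht t (le_n t)). apply bex_iff in Ht. destruct Ht as (p & _ & Hp).
      rewrite Bool.andb_true_iff, bs_eqb_iff in Hp. exists p. split; [|symmetry]; tauto.
  - pose proof (start_block_len c j) as HN.
    assert (firstn (start c (S j)) y = firstn (start c j) y ++ block c j y) as ->.
    { unfold block. rewrite HN. apply firstn_add. }
    split.
    + intros E%app_inv_head. exists 0. intros t' _. apply ball_iff. intros m Hm.
      rewrite <- !nth_block, E by exact Hm. apply Bool.eqb_reflx.
    + intros [t Ht]. specialize (Ht t (le_n t)). rewrite ball_iff in Ht. f_equal.
      apply list_eq_nth; rewrite !length_block by assumption; [reflexivity|].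
      intros i Hi. rewrite !nth_block by exact Hi. now apply Bool.eqb_prop, Ht.
Qed.

Lemma stage_check_mono c x y j t t' : t <= t' ->
  stage_check c x y j t = true -> stage_check c x y j t' = true.
Proof.
  intro H. unfold stage_check. destruct (_ && _); [|auto].
  rewrite !bex_iff. intros (p & Hp & E). exists p. split; [lia|exact E].
Qed.

Lemma run_check_iff c x y k :
  (exists t, forall t', t <= t' -> run_check c x y k t' = true) <-> start c k <= length x /\ Run c x k y.
Proof.
  split.
  - intros [t Ht]. specialize (Ht t (le_n t)). unfold run_check in Ht.
    rewrite !Bool.andb_true_iff, Nat.leb_le, Nat.eqb_eq, bs_eqb_iff, ball_iff in Ht.
    destruct Ht as [[[Hx Hy] H0] H]. split; [exact Hx|].
    assert (forall j, j <= k -> Run c x j (firstn (start c j) y)) as HR.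
    { induction j as [|j IH]; intro Hj; [exact H0|]. exists (firstn (start c j) y).
      split; [apply IH; lia|]. pose proof (start_mono c (S j) k Hj).
      apply stage_check_iff; [lia..|]. exists t. intros t' Ht'.
      apply (stage_check_mono _ _ _ _ _ _ Ht'). apply H. lia. }
    specialize (HR k (le_n k)). now rewrite <- Hy, firstn_all in HR.
  - intros [Hx Hy]. pose proof (Run_length c x k y Hx Hy) as L.
    assert (forall m, m <= k -> exists t, forall j, j < m -> stage_check c x y j t = true) as H.
    { induction m as [|m IH]; intro Hm; [exists 0; lia|].
      destruct IH as [t Ht]; [lia|]. pose proof (Run_step c x m k y Hm Hx Hy) as Hs.
      pose proof (start_mono c (S m) k Hm).
      apply stage_check_iff in Hs; [|lia..]. destruct Hs as [s Hs]. exists (max s t). intros j Hj.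
      destruct (Nat.eq_dec j m) as [->|]; [apply Hs; lia|].
      apply (stage_check_mono _ _ _ _ t); [lia|apply Ht; lia]. }
    destruct (H k (le_n k)) as [t Ht]. exists t. intros t' Ht'. unfold run_check.
    rewrite !Bool.andb_true_iff, Nat.leb_le, Nat.eqb_eq, bs_eqb_iff, ball_iff. repeat split; auto.
    + apply (Run_firstn c x 0 k y); auto. lia.
    + intros j Hj. apply (stage_check_mono _ _ _ _ _ _ Ht'). auto.
Qed.

Lemma Fhat_iff c x y : Fhat c x y <->
  y = [] \/ exists k z, start c k <= length x /\ Run c x k z /\ firstn (length y) z = y.
Proof.
  unfold Fhat, output_check. split.
  - intros [t Ht]. apply Bool.orb_true_iff in Ht. destruct Ht as [Ht|Ht]; [left; now apply bs_eqb_iff|].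
    right. apply bex_iff in Ht. destruct Ht as (k & _ & Ht). apply bex_iff in Ht.
    destruct Ht as (n & _ & Ht). rewrite Bool.andb_true_iff, bs_eqb_iff in Ht. destruct Ht as [Ht E].
    exists k, (dec n). rewrite <- and_assoc, <- run_check_iff. split; [|exact E].
    exists t. intros t' Ht'. unfold run_check in *.
    rewrite !Bool.andb_true_iff, ball_iff in *. repeat split; try tauto.
    intros j Hj. apply (stage_check_mono _ _ _ _ _ _ Ht'). now apply Ht.
  - intros [->|(k & z & H)]; [now exists 0|]. rewrite <- and_assoc, <- run_check_iff in H.
    destruct H as [[t Ht] E]. exists (S (t + k + code_bs z)). apply Bool.orb_true_iff. right.
    apply bex_iff. exists k. split; [lia|]. apply bex_iff. exists (code_bs z). split; [lia|].
    rewrite dec_code, Ht by lia. now apply bs_eqb_iff.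
Qed.

Lemma firstn_length_app {T} (x z : list T) : firstn (length x) (x ++ z) = x.
Proof. now rewrite firstn_app, Nat.sub_diag, firstn_all, firstn_O, app_nil_r. Qed.

Lemma firstn_comparable m n (z : list bool) :
  sub_bs (firstn m z) (firstn n z) \/ sub_bs (firstn n z) (firstn m z).
Proof.
  assert (forall m n, m <= n -> sub_bs (firstn m z) (firstn n z)) as H.
  { intros a b Hab. exists (firstn (b - a) (skipn a z)). rewrite <- firstn_add. f_equal. lia. }
  destruct (Nat.le_ge_cases m n); auto.
Qed.

(** Runs are unique and persist when the input grows, so the run with fewer stages is a truncation
    of the other. The shorter input may carry the longer run, hence the two cases. *)
Lemma Fhat_compatible c x y x' y' : Fhat c x y -> Fhat c x' y' -> sub_bs x x' ->
  sub_bs y y' \/ sub_bs y' y.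
Proof.
  rewrite !Fhat_iff. intros [->|(k & z & Hk & Hz & E)]; [left; now exists y'|].
  intros [->|(k' & z' & Hk' & Hz' & E')]; [right; now exists y|]. intros [w ->].
  assert (forall j v, start c j <= length x -> Run c x j v -> Run c (x ++ w) j v) as Hw.
  { intros j v Hj. apply Run_ext. rewrite firstn_app. replace (start c j - length x) with 0 by lia.
    now rewrite firstn_O, app_nil_r. }
  pose proof (Run_length c _ _ _ Hk Hz) as L. pose proof (Run_length c _ _ _ Hk' Hz') as L'.
  assert (length y <= start c k) by (rewrite <- L, <- E, length_firstn; lia).
  assert (length y' <= start c k') by (rewrite <- L', <- E', length_firstn; lia).
  destruct (Nat.le_ge_cases k k') as [H1|H1].
  - pose proof (Run_firstn c _ k k' z' H1 Hk' Hz') as Hz1.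
    apply (Run_fun _ _ _ _ _ (Hw k z Hk Hz)) in Hz1. subst z.
    rewrite firstn_firstn, Nat.min_l in E by lia. rewrite <- E, <- E'. apply firstn_comparable.
  - pose proof (start_mono c k' k H1). pose proof (Run_firstn c _ k' k z H1 Hk Hz) as Hz1.
    apply Hw in Hz1; [|lia]. apply (Run_fun _ _ _ _ _ Hz') in Hz1. subst z'.
    rewrite firstn_firstn, Nat.min_l in E' by lia. rewrite <- E, <- E'. apply firstn_comparable.
Qed.

Lemma Fhat_operation c : computable_operation (Fhat c).
Proof.
  split; [apply Fhat_re|]. split.
  - intro x. apply Fhat_iff. now left.
  - apply Fhat_compatible.
Qed.

Open Scope R_scope.

(** * Covers and supermartingales *)

Definition lsum {T} (f : T -> R) (l : list T) : R := fold_right (fun x r => f x + r) 0 l.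

Lemma lsum_app {T} (f : T -> R) l l' : lsum f (l ++ l') = lsum f l + lsum f l'.
Proof. induction l as [|a l IH]; simpl; [lra|]. rewrite IH. lra. Qed.

Lemma lsum_map {T U} (f : U -> R) (g : T -> U) l : lsum f (map g l) = lsum (fun x => f (g x)) l.
Proof. induction l as [|a l IH]; simpl; [lra|]. now rewrite IH. Qed.

Lemma lsum_ext {T} (f g : T -> R) l : (forall x, f x = g x) -> lsum f l = lsum g l.
Proof. intro H. induction l as [|a l IH]; simpl; [lra|]. now rewrite IH, H. Qed.

Lemma lsum_le {T} (f g : T -> R) l : (forall x, f x <= g x) -> lsum f l <= lsum g l.
Proof. intro H. induction l as [|a l IH]; simpl; [lra|]. specialize (H a). lra. Qed.

Lemma lsum_scal {T} (f : T -> R) r l : lsum (fun x => r * f x) l = r * lsum f l.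
Proof. induction l as [|a l IH]; simpl; [lra|]. rewrite IH. lra. Qed.

Lemma lsum_plus {T} (f g : T -> R) l : lsum (fun x => f x + g x) l = lsum f l + lsum g l.
Proof. induction l as [|a l IH]; simpl; [lra|]. rewrite IH. lra. Qed.

Lemma lsum_ge0 {T} (f : T -> R) l : (forall x, 0 <= f x) -> 0 <= lsum f l.
Proof. intro H. induction l as [|a l IH]; simpl; [lra|]. specialize (H a). lra. Qed.

Lemma lsum_incl {T} (f : T -> R) l l' : (forall x, 0 <= f x) -> NoDup l -> incl l l' ->
  lsum f l <= lsum f l'.
Proof.
  intros Hf Hl. revert l'. induction Hl as [|a l Ha Hl IH]; intros l' Hi.
  - now apply lsum_ge0.
  - destruct (in_split a l' (Hi a (in_eq a l))) as (l1 & l2 & ->).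
    rewrite lsum_app. simpl. specialize (IH (l1 ++ l2)). rewrite lsum_app in IH.
    assert (incl l (l1 ++ l2)) as Hi'; [|specialize (IH Hi'); lra].
    intros x Hx. specialize (Hi x (in_cons a x l Hx)). rewrite in_app_iff in *.
    destruct Hi as [|[->|]]; auto. contradiction.
Qed.

Lemma sum_f_R0_lsum f n : sum_f_R0 f n = lsum f (seq 0 (S n)).
Proof.
  induction n as [|n IH]; simpl sum_f_R0; [simpl; lra|].
  rewrite (seq_S (S n) 0), lsum_app, IH. simpl. lra.
Qed.

Lemma lsum_list_prod {T U} (f : T -> U -> R) l l' :
  lsum (fun p => f (fst p) (snd p)) (list_prod l l') = lsum (fun x => lsum (f x) l') l.
Proof. induction l as [|a l IH]; simpl; [lra|]. now rewrite lsum_app, lsum_map, IH. Qed.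

Definition weight (o : option (list bool)) : R :=
  match o with Some x => (/ 2) ^ length x | None => 0 end.

Lemma weight_ge0 o : 0 <= weight o.
Proof. destruct o; simpl; [apply pow_le|]; lra. Qed.

Lemma outer_measure_le_mono (A B : seqb -> Prop) e e' : (forall al, A al -> B al) -> e <= e' ->
  outer_measure_le B e -> outer_measure_le A e'.
Proof.
  intros HA He HB eta Heta. destruct (HB eta Heta) as (cov & H1 & H2). exists cov. split; [auto|].
  intro N. specialize (H2 N). lra.
Qed.

(** The [n]-th cover gets the slack [eta * 2^-(n+1)], and the covers are merged along the pairing.
    The first [N + 1] pairs lie in a square of side [N + 1], so each partial sum is at most a sum
    over rows. *)
Lemma outer_measure_le_union (A : nat -> seqb -> Prop) (e : nat -> R) E :
  (forall n, outer_measure_le (A n) (e n)) -> (forall N, sum_f_R0 e N <= E) ->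
  outer_measure_le (fun al => exists n, A n al) E.
Proof.
  intros HA HE eta Heta.
  assert (forall n, 0 < eta * (/ 2) ^ S n) as Hpos.
  { intro n. apply Rmult_lt_0_compat; [lra|]. apply pow_lt. lra. }
  pose proof (fun n => constructive_indefinite_description _ (HA n _ (Hpos n))) as C.
  exists (fun k => proj1_sig (C (pfst k)) (psnd k)). split.
  - intros al [n Hn]. destruct (proj2_sig (C n)) as [H1 _]. destruct (H1 al Hn) as (k & x & Hk & Hx).
    exists (to_nat (n, k)), x. rewrite pfst_to_nat, psnd_to_nat. auto.
  - intro N. change (sum_f_R0 (fun k => weight (proj1_sig (C (pfst k)) (psnd k))) N <= E + eta).
    set (w := fun i j => weight (proj1_sig (C i) j)).
    change (sum_f_R0 (fun k => w (pfst k) (psnd k)) N <= E + eta).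
    rewrite sum_f_R0_lsum.
    apply Rle_trans with (lsum (fun p => w (fst p) (snd p))
      (list_prod (seq 0 (S N)) (seq 0 (S N)))).
    + rewrite <- (lsum_map (fun p => w (fst p) (snd p)) (fun k => of_nat k)).
      apply lsum_incl.
      * intros p. apply weight_ge0.
      * apply FinFun.Injective_map_NoDup; [exact of_nat_inj|apply seq_NoDup].
      * intros p Hp. apply in_map_iff in Hp. destruct Hp as (k & <- & Hk%in_seq).
        rewrite (surjective_pairing (of_nat k)). pose proof (pfst_le k). pose proof (psnd_le k).
        unfold pfst, psnd in *. apply in_prod; apply in_seq; lia.
    + rewrite lsum_list_prod.
      apply Rle_trans with (lsum (fun n => e n + eta * (/ 2) ^ S n) (seq 0 (S N))).
      * apply lsum_le. intro n. rewrite <- sum_f_R0_lsum. apply (proj2 (proj2_sig (C n))).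
      * rewrite lsum_plus, (lsum_scal (fun n => (/ 2) ^ S n)), <- !sum_f_R0_lsum. specialize (HE N).
        assert (sum_f_R0 (fun n => (/ 2) ^ S n) N = 1 - (/ 2) ^ S N) as ->.
        { clear. induction N as [|N IH]; [simpl; lra|]. rewrite tech5, IH. simpl. lra. }
        pose proof (Hpos N). lra.
Qed.

Lemma outer_measure_le_or A B a b : outer_measure_le A a -> outer_measure_le B b -> 0 <= a -> 0 <= b ->
  outer_measure_le (fun al => A al \/ B al) (a + b).
Proof.
  intros HA HB Ha Hb.
  apply (outer_measure_le_mono _
    (fun al => exists n, match n with 0%nat => A al | 1%nat => B al | _ => False end)
    (a + b) (a + b)); [|lra|].
  - intros al [H|H]; [now exists 0%nat|now exists 1%nat].
  - apply (outer_measure_le_union _ (fun n => match n with 0%nat => a | 1%nat => b | _ => 0 end)).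
    + intros [|[|n]]; [exact HA|exact HB|]. intros eta Heta. exists (fun _ => None).
      split; [tauto|]. intro N. rewrite sum_eq_R0; [lra|reflexivity].
    + intro N.
      assert (forall n,
        sum_f_R0 (fun n => match n with 0%nat => a | 1%nat => b | _ => 0 end) (S n) = a + b) as H.
      { induction n as [|n IH]; [reflexivity|]. rewrite tech5, IH. lra. }
      destruct N; [simpl; lra|]. rewrite H. lra.
Qed.

(** The weight [2^-|x|] if [x] is minimal among its prefixes with [1 <= d x], and 0 otherwise.
    Shifting [d] at the first bit lets the sum over all strings be bounded by induction on the
    depth. *)
Fixpoint first_hit (d : list bool -> R) (x : list bool) : R :=
  match x with
  | [] => if Rle_dec 1 (d []) then 1 else 0
  | b :: x => if Rle_dec 1 (d []) then 0 else first_hit (fun y => d (b :: y)) x / 2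
  end.

Lemma first_hit_cases d x : first_hit d x = 0 \/ first_hit d x = (/ 2) ^ length x.
Proof.
  revert d. induction x as [|b x IH]; intro d; simpl; destruct (Rle_dec 1 (d [])); auto.
  destruct (IH (fun y => d (b :: y))) as [-> | ->]; [left|right]; lra.
Qed.

Lemma first_hit_ge0 d x : 0 <= first_hit d x.
Proof. destruct (first_hit_cases d x) as [-> | ->]; [lra|]. apply pow_le. lra. Qed.

Lemma first_hit_exists d x : 1 <= d x -> exists m, 0 < first_hit d (firstn m x).
Proof.
  revert d. induction x as [|b x IH]; intros d H.
  - exists 0%nat. simpl. destruct (Rle_dec 1 (d [])); lra.
  - destruct (Rle_dec 1 (d [])) as [H0|H0].
    + exists 0%nat. simpl. destruct (Rle_dec 1 (d [])); lra.
    + destruct (IH (fun y => d (b :: y)) H) as [m Hm]. exists (S m). simpl.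
      destruct (Rle_dec 1 (d [])); lra.
Qed.

Fixpoint strings (n : nat) : list (list bool) :=
  match n with
  | O => [[]]
  | S n => [] :: map (cons false) (strings n) ++ map (cons true) (strings n)
  end.

Lemma in_strings n x : (length x <= n)%nat -> In x (strings n).
Proof.
  revert x. induction n as [|n IH]; intros [|b x] H; simpl in *; auto; [lia|].
  right. apply in_app_iff. destruct b; [right|left]; apply in_map, IH; lia.
Qed.

Definition supermartingale (d : list bool -> R) : Prop :=
  forall x, 0 <= d x /\ d (x ++ [false]) + d (x ++ [true]) <= 2 * d x.

Lemma first_hit_sum d n : supermartingale d -> lsum (first_hit d) (strings n) <= d [].
Proof.
  revert d. induction n as [|n IH]; intros d Hd; simpl.
  - destruct (Rle_dec 1 (d [])); destruct (Hd []); lra.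
  - rewrite lsum_app, !lsum_map. simpl. destruct (Hd []) as [H0 H1]. simpl in H1.
    destruct (Rle_dec 1 (d [])).
    + assert (lsum (fun _ : list bool => 0) (strings n) = 0) as ->; [|lra].
      rewrite (lsum_ext _ (fun x => 0 * 0)), (lsum_scal (fun _ => 0)); intros; lra.
    + assert (forall b, lsum (fun x => first_hit (fun y => d (b :: y)) x / 2) (strings n)
        = / 2 * lsum (first_hit (fun y => d (b :: y))) (strings n)) as E.
      { intro b. rewrite <- lsum_scal. apply lsum_ext. intro x. lra. }
      rewrite !E. pose proof (IH (fun y => d (false :: y)) (fun x => Hd (false :: x))).
      pose proof (IH (fun y => d (true :: y)) (fun x => Hd (true :: x))). simpl in *. lra.
Qed.

Lemma length_prefix om n : length (prefix om n) = n.
Proof. induction n as [|n IH]; simpl; [reflexivity|]. rewrite length_app, IH. simpl. lia. Qed.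

Lemma firstn_prefix om m n : (m <= n)%nat -> firstn m (prefix om n) = prefix om m.
Proof.
  induction 1 as [|n H IH].
  - rewrite <- (length_prefix om m) at 1. apply firstn_all.
  - simpl. rewrite firstn_app, length_prefix, IH. replace (m - n)%nat with 0%nat by lia. apply app_nil_r.
Qed.

Lemma nth_prefix om n i : (i < n)%nat -> nth i (prefix om n) false = om i.
Proof.
  intro H. rewrite <- (firstn_skipn (S i) (prefix om n)), firstn_prefix by lia. simpl.
  rewrite app_nth1 by (rewrite length_app, length_prefix; simpl; lia).
  rewrite app_nth2; rewrite length_prefix; [|lia]. now rewrite Nat.sub_diag.
Qed.

Lemma length_dec n : (length (dec n) <= n)%nat.
Proof.
  rewrite <- (code_dec n) at 2. induction (dec n); cbn [length code_bs]; lia.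
Qed.

(** The minimal strings on which [d] reaches 1 cover the event, and [first_hit_sum] bounds their
    total weight. [dec] enumerates each string exactly once. *)
Lemma ville_inequality d : supermartingale d ->
  outer_measure_le (fun al => exists n, 1 <= d (prefix al n)) (d []).
Proof.
  intros Hd eta Heta.
  exists (fun k => if Rlt_dec 0 (first_hit d (dec k)) then Some (dec k) else None). split.
  - intros al [n Hn]. destruct (first_hit_exists d _ Hn) as [m Hm].
    assert (firstn m (prefix al n) = prefix al (min m n)) as E.
    { destruct (Nat.le_ge_cases m n).
      - rewrite Nat.min_l by lia. now apply firstn_prefix.
      - rewrite Nat.min_r, firstn_all2 by (rewrite ?length_prefix; lia). reflexivity. }
    rewrite E in Hm. exists (code_bs (prefix al (min m n))), (prefix al (min m n)). rewrite dec_code.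
    destruct (Rlt_dec 0 _); [|contradiction]. split; [reflexivity|].
    unfold prefix_of. now rewrite length_prefix.
  - intro N. apply Rle_trans with (d []); [|lra]. apply Rle_trans with (lsum (first_hit d) (strings N));
      [|now apply first_hit_sum].
    rewrite sum_f_R0_lsum.
    apply Rle_trans with (lsum (fun k => first_hit d (dec k)) (seq 0 (S N))).
    + apply lsum_le. intro k. destruct (Rlt_dec 0 _); [|apply first_hit_ge0].
      destruct (first_hit_cases d (dec k)); lra.
    + rewrite <- (lsum_map (first_hit d) dec). apply lsum_incl; [apply first_hit_ge0| |].
      * apply FinFun.Injective_map_NoDup; [|apply seq_NoDup].
        intros m n H. rewrite <- (code_dec m), H. apply code_dec.
      * intros x Hx. apply in_map_iff in Hx. destruct Hx as (k & <- & Hk%in_seq).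
        apply in_strings. pose proof (length_dec k). lia.
Qed.

Fixpoint mean (n : nat) (h : list bool -> R) : R :=
  match n with
  | O => h []
  | S n => (mean n (fun z => h (false :: z)) + mean n (fun z => h (true :: z))) / 2
  end.

Lemma mean_S n h :
  mean (S n) h = (mean n (fun z => h (false :: z)) + mean n (fun z => h (true :: z))) / 2.
Proof. reflexivity. Qed.

Lemma mean_le n h h' : (forall z, length z = n -> h z <= h' z) -> mean n h <= mean n h'.
Proof.
  revert h h'. induction n as [|n IH]; intros h h' H; simpl; [now apply H|].
  pose proof (IH (fun z => h (false :: z)) (fun z => h' (false :: z)) ltac:(intros; apply H; simpl; lia)).
  pose proof (IH (fun z => h (true :: z)) (fun z => h' (true :: z)) ltac:(intros; apply H; simpl; lia)).
  lra.
Qed.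

Lemma mean_ext n h h' : (forall z, length z = n -> h z = h' z) -> mean n h = mean n h'.
Proof. intro H. apply Rle_antisym; apply mean_le; intros z Hz; rewrite (H z Hz); lra. Qed.

Lemma mean_const n r : mean n (fun _ => r) = r.
Proof. induction n as [|n IH]; simpl; [reflexivity|]. rewrite IH. lra. Qed.

Lemma mean_lin n a b h h' : mean n (fun z => a * h z + b * h' z) = a * mean n h + b * mean n h'.
Proof.
  revert h h'. induction n as [|n IH]; intros h h'; simpl; [reflexivity|]. rewrite !IH. lra.
Qed.

Lemma mean_ones n m a b : (m <= n)%nat ->
  mean n (fun z => if ball m (fun i => nth i z false) then a else b) = (/ 2) ^ m * a + (1 - (/ 2) ^ m) * b.
Proof.
  revert n. induction m as [|m IH]; intros n H.
  - simpl. rewrite mean_const. lra.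
  - destruct n as [|n]; [lia|]. rewrite mean_S.
    assert (forall c z, ball (S m) (fun i => nth i (c :: z) false) =
      (c && ball m (fun i => nth i z false))%bool) as E.
    { intros c z. apply Bool.eq_iff_eq_true. rewrite Bool.andb_true_iff, !ball_iff. split.
      - intro H'. split; [apply (H' 0%nat); lia|]. intros i Hi. apply (H' (S i)). lia.
      - intros [H1 H2] [|i] Hi; [exact H1|]. apply H2. lia. }
    rewrite (mean_ext n _ (fun _ => b)), mean_const by (intros z _; cbv beta; now rewrite E).
    rewrite (mean_ext n _ (fun z => if ball m (fun i => nth i z false) then a else b))
      by (intros z _; cbv beta; now rewrite E).
    rewrite IH by lia. simpl. lra.
Qed.

Fixpoint stage_of (c n : nat) : nat :=
  match n with
  | O => O
  | S m => if (S m <=? start c (stage_of c m))%nat then stage_of c m else S (stage_of c m)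
  end.

Lemma stage_of_spec c n : (n <= start c (stage_of c n) /\ forall k, n <= start c k -> stage_of c n <= k)%nat.
Proof.
  induction n as [|n [IH1 IH2]]; cbn [stage_of]; [split; lia|].
  destruct (Nat.leb_spec (S n) (start c (stage_of c n))) as [H|H].
  - split; [exact H|]. intros k Hk. apply IH2. lia.
  - split.
    + pose proof (start_gt c (stage_of c n)). rewrite start_S. lia.
    + intros k Hk. assert (stage_of c n <= k)%nat by (apply IH2; lia).
      destruct (Nat.eq_dec (stage_of c n) k) as [E|]; [rewrite E in H; lia|lia].
Qed.

Lemma stage_of_start c k : stage_of c (start c k) = k.
Proof.
  destruct (stage_of_spec c (start c k)) as [H1 H2]. specialize (H2 k (le_n _)).
  destruct (Nat.eq_dec (stage_of c (start c k)) k) as [|H]; [assumption|].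
  pose proof (start_mono c (S (stage_of c (start c k))) k ltac:(lia)) as H3. rewrite start_S in H3.
  pose proof (start_gt c k). lia.
Qed.

(** [V] is a supermartingale sampled at the ends of stages. Inside a stage, [d] takes the expected
    value of [V] at the end of that stage, which extends it to all strings. *)
Lemma outer_measure_le_stages c (V : nat -> list bool -> R) e :
  (forall k x, 0 <= V k x) ->
  (forall k x, length x = start c k -> mean (block_len c k) (fun z => V (S k) (x ++ z)) <= V k x) ->
  (forall x, length x = start c 0 -> V 0%nat x <= e) ->
  outer_measure_le (fun al => exists k, 1 <= V k (prefix al (start c k))) e.
Proof.
  intros H0 HV He.
  set (d := fun x => mean (start c (stage_of c (length x)) - length x)
                          (fun z => V (stage_of c (length x)) (x ++ z))).
  assert (forall k x, length x = start c k -> d x = V k x) as Hd.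
  { intros k x Hx. unfold d. rewrite Hx, stage_of_start, Nat.sub_diag. simpl. now rewrite app_nil_r. }
  apply (outer_measure_le_mono _ (fun al => exists n, 1 <= d (prefix al n)) (d []) e).
  - intros al [k Hk]. exists (start c k). rewrite (Hd k); [exact Hk|apply length_prefix].
  - unfold d. cbn [length stage_of]. rewrite <- (mean_const (start c 0 - 0) e). apply mean_le.
    intros z Hz. apply He. simpl. lia.
  - apply ville_inequality. intro x. split.
    + unfold d. rewrite <- (mean_const (start c (stage_of c (length x)) - length x) 0). now apply mean_le.
    + assert (forall n k b, mean n (fun z => V k ((x ++ [b]) ++ z)) =
        mean n (fun z => V k (x ++ b :: z))) as Happ.
      { intros n k b. apply mean_ext. intros z _. now rewrite <- app_assoc. }
      destruct (stage_of_spec c (length x)) as [H1 H2]. unfold d.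
      rewrite !length_app, !Nat.add_1_r. cbn [stage_of].
      (* Either one more bit stays within the current stage, where the average is preserved exactly,
         or [x] ends at a stage boundary, where the hypothesis on [V] is used. *)
      destruct (Nat.leb_spec (S (length x)) (start c (stage_of c (length x)))) as [H|H].
      * replace (start c (stage_of c (length x)) - length x)%nat
          with (S (start c (stage_of c (length x)) - S (length x))) by lia. rewrite mean_S.
        apply Req_le. rewrite !Happ. lra.
      * assert (length x = start c (stage_of c (length x))) as E by lia.
        set (k := stage_of c (length x)) in *. specialize (HV k x E).
        rewrite E. pose proof (start_block_len c k) as HN. pose proof (block_len_eq c k). pose proof (start_gt c k).
        rewrite Nat.sub_diag. simpl (mean 0 _). rewrite app_nil_r.
        replace (block_len c k) with (S (start c (S k) - S (start c k))) in HV by lia. rewrite mean_S in HV.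
        rewrite !Happ. lra.
Qed.

(** * Exceptional inputs *)

Definition asbool (P : Prop) : bool := if excluded_middle_informative P then true else false.

Lemma asbool_iff P : asbool P = true <-> P.
Proof. unfold asbool. destruct excluded_middle_informative; split; auto; discriminate. Qed.

Lemma asbool_ext P Q : (P <-> Q) -> asbool P = asbool Q.
Proof. intro H. apply Bool.eq_iff_eq_true. now rewrite !asbool_iff. Qed.

Definition attempted (c i : nat) (x : list bool) (j : nat) : Prop :=
  task_of j = i /\ exists u, Run c x j u /\ att c u j = true.

Definition unresolved (c i : nat) (x : list bool) (j : nat) : Prop :=
  task_of j = i /\ exists u, Run c x j u /\ att c u j = true /\ ~ exists p, ok c i j u p = true.

Lemma atts_ext c u u' k : firstn (start c k) u = firstn (start c k) u' -> forall a,
  atts c u k = atts c u' k /\ unblocked c u k a = unblocked c u' k a.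
Proof.
  assert (forall k a, firstn (start c k) u = firstn (start c k) u' ->
    unblocked c u k a = unblocked c u' k a) as Hu.
  { clear k. intros k a E. unfold unblocked. apply ball_ext. intros j Hj.
    rewrite (firstn_le u u' (start c j) (start c k)); [reflexivity|apply start_mono; lia|exact E]. }
  intros E a. split; [|now apply Hu]. revert E. induction k as [|k IH]; intro E; [reflexivity|].
  apply (firstn_le u u' (start c k)) in E; [|apply start_mono; lia].
  change (atts c u k ++ [unblocked c u k (atts c u k)] =
    atts c u' k ++ [unblocked c u' k (atts c u' k)]).
  now rewrite (IH E), (Hu k).
Qed.

Lemma att_ext c u u' k : firstn (start c k) u = firstn (start c k) u' -> att c u k = att c u' k.
Proof.
  intro E. unfold att. destruct (atts_ext c u u' k E (atts c u k)) as [E1 ->]. now rewrite E1.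
Qed.

Lemma atts_nth c u k : length (atts c u k) = k /\
  forall j, (j < k)%nat -> nth j (atts c u k) false = att c u j.
Proof.
  induction k as [|k [L IH]]; [split; [reflexivity|lia]|].
  change (atts c u (S k)) with (atts c u k ++ [att c u k]). rewrite length_app, L.
  split; [simpl; lia|]. intros j Hj. destruct (Nat.eq_dec j k) as [->|].
  - rewrite app_nth2; rewrite L; [|lia]. now rewrite Nat.sub_diag.
  - rewrite app_nth1 by lia. apply IH. lia.
Qed.

Lemma att_iff c u k : att c u k = true <-> forall j, (j < k)%nat -> task_of j = task_of k ->
  att c u j = true -> exists p, (p <= k)%nat /\ ok c (task_of j) j (firstn (start c j) u) p = true.
Proof.
  unfold att at 1, unblocked. rewrite ball_iff. destruct (atts_nth c u k) as [_ Hn].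
  split; intros H j Hj; specialize (H j Hj); rewrite (Hn j Hj) in *.
  - intros E1 E2. rewrite E1, E2, Nat.eqb_refl in H. cbn [andb implb] in H.
    apply bex_iff in H. destruct H as (p & Hp & H). rewrite <- E1 in H. exists p. split; [lia|exact H].
  - destruct (Nat.eqb_spec (task_of j) (task_of k)) as [E1|]; [|reflexivity].
    destruct (att c u j); [|reflexivity]. cbn [andb implb]. apply bex_iff.
    destruct (H E1 eq_refl) as (p & Hp & Ho). exists p. split; [lia|exact Ho].
Qed.

Lemma attempted_ext c i x x' j : firstn (start c j) x = firstn (start c j) x' ->
  attempted c i x j <-> attempted c i x' j.
Proof.
  intro E. split; intros (H & u & Hu & H'); (split; [exact H|]); exists u; (split; [|exact H']);
    revert Hu; now apply Run_ext.
Qed.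

Lemma unresolved_ext c i x x' j : firstn (start c j) x = firstn (start c j) x' ->
  unresolved c i x j <-> unresolved c i x' j.
Proof.
  intro E. split; intros (H & u & Hu & H'); (split; [exact H|]); exists u; (split; [|exact H']);
    revert Hu; now apply Run_ext.
Qed.

(* An attempt waits until all earlier attempts of the same type are resolved. *)
Lemma unresolved_unique c i x j k : (start c k <= length x)%nat -> (j < k)%nat ->
  unresolved c i x j -> ~ attempted c i x k.
Proof.
  intros Hx Hj (Tj & u & Hu & Au & Nu) (Tk & v & Hv & Av).
  rewrite att_iff in Av.
  pose proof (Run_firstn c x j k v ltac:(lia) Hx Hv) as Hv'.
  rewrite (Run_fun _ _ _ _ _ Hu Hv') in *.
  destruct (Av j Hj) as (p & _ & Hp); [congruence| |].
  - rewrite <- Au. apply att_ext. now rewrite firstn_firstn, Nat.min_id.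
  - apply Nu. exists p. now rewrite <- Tj.
Qed.

Lemma hold_app c k x z : length x = start c k ->
  hold c k (x ++ z) = ball (task_of k + c) (fun m => nth m z false).
Proof.
  intro Hx. apply ball_ext. intros m _. rewrite <- Hx. rewrite app_nth2 by lia. f_equal. lia.
Qed.

Lemma firstn_app_le {T} m (x z : list T) : (m <= length x)%nat -> firstn m (x ++ z) = firstn m x.
Proof.
  intro H. rewrite firstn_app. replace (m - length x)%nat with 0%nat by lia. apply app_nil_r.
Qed.

Lemma half_pow_bounds n : 0 < (/ 2) ^ n <= 1.
Proof.
  split; [apply pow_lt; lra|]. rewrite <- (pow1 n). apply pow_incr. lra.
Qed.

Definition lost (c i : nat) (al : seqb) : Prop := exists k,
  unresolved c i (prefix al (start c k)) k /\ hold c k (prefix al (start c (S k))) = true.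

(** A single bet: the capital stays at [2^-(i+c)] until the first unresolved stage of [i], and there
    it becomes 1 if the stage is held and 0 otherwise. The bet is fair, and by [unresolved_unique]
    no second unresolved stage can change the outcome. *)
Lemma lost_small c i : outer_measure_le (lost c i) ((/ 2) ^ (i + c)).
Proof.
  set (hit := fun k x => exists j, (j < k)%nat /\ unresolved c i x j).
  set (bad := fun k x => exists j, (j < k)%nat /\ unresolved c i x j /\ hold c j x = true).
  set (V := fun k x => if asbool (hit k x) then if asbool (bad k x) then 1 else 0 else (/ 2) ^ (i + c)).
  pose proof (half_pow_bounds (i + c)) as W.
  apply (outer_measure_le_mono _ (fun al => exists k, 1 <= V k (prefix al (start c k))) ((/ 2) ^ (i + c))
    _); [|lra|].
  - intros al (k & H1 & H2). exists (S k). unfold V.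
    assert (unresolved c i (prefix al (start c (S k))) k) as H1'.
    { revert H1. apply unresolved_ext. now rewrite !firstn_prefix by (apply start_mono; lia). }
    rewrite (proj2 (asbool_iff (hit _ _))) by (exists k; auto).
    rewrite (proj2 (asbool_iff (bad _ _))) by (exists k; auto). lra.
  - apply outer_measure_le_stages.
    + intros k x. unfold V. destruct (asbool (hit k x)), (asbool (bad k x)); lra.
    + intros k x Hx.
      assert (forall z j, (j <= k)%nat -> unresolved c i (x ++ z) j <-> unresolved c i x j) as Eu.
      { intros z j Hj. apply unresolved_ext, firstn_app_le. rewrite Hx. now apply start_mono. }
      assert (forall z j, (j < k)%nat -> hold c j (x ++ z) = hold c j x) as Eh.
      { intros z j Hj. apply hold_ext, firstn_app_le. rewrite Hx. now apply start_mono. }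
      destruct (asbool (hit k x)) eqn:Hh.
      * rewrite <- (mean_const (block_len c k) (V k x)). apply mean_le. intros z _. apply Req_le.
        assert (hit k x) as (j0 & Hj0 & Hu0) by now apply asbool_iff.
        unfold V. rewrite Hh.
        rewrite (proj2 (asbool_iff (hit (S k) (x ++ z)))) by (exists j0; split; [lia|apply Eu; auto; lia]).
        rewrite (asbool_ext (bad (S k) (x ++ z)) (bad k x)); [reflexivity|].
        split; intros (j & Hj & Hu & Hd).
        -- destruct (Nat.eq_dec j k) as [->|].
           ++ exfalso. apply Eu in Hu; [|lia].
              apply (unresolved_unique c i x j0 k); auto; [lia|].
              destruct Hu as (T & u & R1 & R2 & _). split; eauto.
           ++ exists j. rewrite <- Eu with (z := z), <- Eh with (z := z) by lia.
              split; [lia|auto].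
        -- exists j. rewrite Eu, Eh by lia. split; [lia|auto].
      * assert (~ hit k x) as Hn by (intro Hi; apply (proj2 (asbool_iff _)) in Hi; congruence).
        replace (V k x) with ((/ 2) ^ (i + c)) by (unfold V; now rewrite Hh).
        destruct (excluded_middle_informative (unresolved c i x k)) as [Hu|Hu].
        -- pose proof (proj1 Hu) as T.
           replace ((/ 2) ^ (i + c)) with ((/ 2) ^ (i + c) * 1 + (1 - (/ 2) ^ (i + c)) * 0) by lra.
           rewrite <- (mean_ones (block_len c k)) by (rewrite <- T; apply hold_room).
           apply mean_le. intros z _. unfold V.
           rewrite (proj2 (asbool_iff (hit (S k) (x ++ z)))) by (exists k; split; [lia|apply Eu; auto]).
           rewrite <- T, <- (hold_app c k x z Hx).
           destruct (asbool (bad _ _)) eqn:Hb; [|destruct (hold c k (x ++ z)); lra].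
           apply (proj1 (asbool_iff _)) in Hb. destruct Hb as (j & Hj & Hju & Hjh).
           destruct (Nat.eq_dec j k) as [->|]; [rewrite Hjh; lra|].
           exfalso. apply Hn. exists j. split; [lia|]. apply (Eu z); [lia|exact Hju].
        -- rewrite <- (mean_const (block_len c k) ((/ 2) ^ (i + c))). apply mean_le. intros z _.
           unfold V. destruct (asbool (hit (S k) (x ++ z))) eqn:Hz; [|lra].
           apply (proj1 (asbool_iff _)) in Hz. destruct Hz as (j & Hj & Hju). exfalso.
           apply Eu in Hju; [|lia]. destruct (Nat.eq_dec j k) as [->|]; [contradiction|].
           apply Hn. exists j. split; [lia|exact Hju].
    + intros x _. unfold V. destruct (asbool (hit 0%nat x)) eqn:E; [|lra].
      apply (proj1 (asbool_iff _)) in E. destruct E as (j & Hj & _). lia.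
Qed.

Definition never_held (c i K : nat) (al : seqb) : Prop :=
  (forall K', exists k, (K' <= k)%nat /\ attempted c i (prefix al (start c k)) k) /\
  (forall k, (K <= k)%nat -> attempted c i (prefix al (start c k)) k ->
     hold c k (prefix al (start c (S k))) = false).

(** Betting against holding: at each attempted stage from [K] on, the capital is multiplied by
    [g = 1 / (1 - w)] if the stage is not held and lost otherwise, which is fair as holding has
    probability [w]. On [never_held] it grows without bound from any positive start. *)
Lemma never_held_null c i K : (1 <= c)%nat -> outer_measure_le (never_held c i K) 0.
Proof.
  intros Hc eta Heta. pose proof (half_pow_bounds (i + c)) as W.
  set (w := (/ 2) ^ (i + c)) in *.
  (* Here [1 <= c] matters: for [i = c = 0] every attempted stage would be held and [g] would be
     infinite. *)
  assert (w < 1) as W1.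
  { unfold w. destruct c as [|c]; [lia|]. rewrite Nat.add_succ_r. simpl.
    pose proof (half_pow_bounds (i + c)). lra. }
  set (g := / (1 - w)).
  assert (1 < g) as Hg by (unfold g; rewrite <- Rinv_1 at 1; apply Rinv_lt_contravar; lra).
  set (fac := fun k x => if asbool (attempted c i x k) && (K <=? k)%nat
                         then if hold c k x then 0 else g else 1).
  set (V := fun k x => nat_rect (fun _ => R) (eta / 2) (fun j r => r * fac j x) k).
  assert (forall k x, V (S k) x = V k x * fac k x) as VS by reflexivity.
  assert (forall k x x', firstn (start c (S k)) x = firstn (start c (S k)) x' -> fac k x = fac k x') as Ef.
  { intros k x x' E. unfold fac. rewrite (hold_ext c k x x' E).
    rewrite (asbool_ext _ (attempted c i x' k)); [reflexivity|]. apply attempted_ext.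
    apply (firstn_le x x' (start c k) (start c (S k))); [apply start_mono; lia|exact E]. }
  assert (forall k x x', firstn (start c k) x = firstn (start c k) x' -> V k x = V k x') as EV.
  { induction k as [|k IH]; intros x x' E; [reflexivity|]. rewrite !VS, (Ef k x x' E).
    f_equal. apply IH. apply (firstn_le x x' (start c k) (start c (S k))); [apply start_mono; lia|exact E]. }
  assert (forall k x, 0 <= fac k x) as Hf.
  { intros k x. unfold fac. destruct (_ && _); [|lra]. destruct (hold c k x); lra. }
  assert (forall k x, 0 <= V k x) as HV.
  { induction k as [|k IH]; intro x; [simpl; lra|]. rewrite VS. apply Rmult_le_pos; auto. }
  (* Half of [eta] is the initial capital, the other half the slack of the cover. *)
  enough (outer_measure_le (never_held c i K) (eta / 2)) as H.
  { destruct (H (eta / 2)) as (cov & H1 & H2); [lra|]. exists cov. split; [exact H1|].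
    intro N. specialize (H2 N). lra. }
  apply (outer_measure_le_mono _ (fun al => exists k, 1 <= V k (prefix al (start c k))) (eta / 2)
    (eta / 2)); [|lra|].
  - intros al [Hinf Hno].
    set (v := fun k => V k (prefix al (start c k))).
    assert (forall k, v (S k) = v k * fac k (prefix al (start c (S k)))) as vS.
    { intro k. unfold v. rewrite VS. f_equal. apply EV.
      now rewrite !firstn_prefix by (apply start_mono; lia). }
    assert (forall k, attempted c i (prefix al (start c (S k))) k <-> attempted c i (prefix al (start c k)) k) as Ea.
    { intro k. apply attempted_ext. now rewrite !firstn_prefix by (apply start_mono; lia). }
    assert (forall k, v k <= v (S k)) as vmono.
    { intro k. rewrite vS. rewrite <- (Rmult_1_r (v k)) at 1. apply Rmult_le_compat_l; [apply HV|].
      unfold fac. destruct (asbool _ && _) eqn:E; [|lra].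
      apply Bool.andb_true_iff in E. rewrite asbool_iff, Nat.leb_le, Ea in E.
      rewrite Hno by tauto. lra. }
    assert (forall j k, (j <= k)%nat -> v j <= v k) as vmono'.
    { induction 1 as [|k _ IH]; [lra|]. specialize (vmono k). lra. }
    assert (forall n, exists k, eta / 2 * g ^ n <= v k) as Hgrow.
    { induction n as [|n [k Hk]]; [exists 0%nat; unfold v; simpl; lra|].
      destruct (Hinf (max k K)) as (k' & Hk' & Ha). exists (S k'). rewrite vS.
      unfold fac. rewrite (proj2 (asbool_iff _)) by now apply Ea.
      rewrite (proj2 (Nat.leb_le K k')) by lia. cbn [andb]. rewrite Hno by (auto; lia).
      specialize (vmono' k k' ltac:(lia)). simpl.
      rewrite (Rmult_comm g), <- Rmult_assoc. apply Rmult_le_compat_r; lra. }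
    destruct (Pow_x_infinity g ltac:(rewrite Rabs_right; lra) (2 / eta)) as [n Hn].
    specialize (Hn n (le_n n)). destruct (Hgrow n) as [k Hk]. exists k.
    rewrite Rabs_right in Hn by (apply Rle_ge, pow_le; lra).
    apply Rle_trans with (2 := Hk). apply Rge_le in Hn.
    apply (Rmult_le_compat_l (eta / 2)) in Hn; [|lra].
    replace (eta / 2 * (2 / eta)) with 1 in Hn by (field; lra). exact Hn.
  - apply outer_measure_le_stages; [exact HV| |intros; simpl; lra].
    intros k x Hx.
    rewrite (mean_ext _ _ (fun z => V k x * fac k (x ++ z) + 0 * 0)).
    2:{ intros z _. rewrite VS, (EV k (x ++ z) x); [lra|]. apply firstn_app_le. lia. }
    rewrite (mean_lin _ _ _ _ (fun _ => 0)).
    assert (mean (block_len c k) (fun z => fac k (x ++ z)) <= 1) as Hm.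
    { unfold fac.
      assert (forall z, asbool (attempted c i (x ++ z) k) = asbool (attempted c i x k)) as E.
      { intro z. apply asbool_ext, attempted_ext, firstn_app_le. lia. }
      destruct (asbool (attempted c i x k) && (K <=? k)%nat) eqn:Ek.
      - assert (task_of k = i) as T.
        { apply Bool.andb_true_iff in Ek. rewrite asbool_iff in Ek. apply Ek. }
        rewrite (mean_ext _ _ (fun z => if ball (i + c) (fun m => nth m z false) then 0 else g)).
        2:{ intros z _. rewrite E, Ek, (hold_app c k x z Hx), T. reflexivity. }
        rewrite mean_ones by (rewrite <- T; apply hold_room). fold w. unfold g.
        apply Req_le. field. lra.
      - rewrite (mean_ext _ _ (fun _ => 1)), mean_const; [lra|].
        intros z _. now rewrite E, Ek. }
    specialize (HV k x). apply (Rmult_le_compat_l _ _ _ HV) in Hm. rewrite mean_const. lra.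
Qed.

(** * Scores of random blocks *)

Lemma state_stable i n t t' : halted i n t = true -> (t <= t')%nat -> state i n t' = state i n t.
Proof.
  intros H Ht. unfold halted in H. apply Nat.eqb_eq in H.
  replace t' with (t + (t' - t))%nat by lia. unfold state at 1. rewrite steps_add.
  fold (state i n t). rewrite <- (to_nat_pfst_psnd (state i n t)), H. apply steps_halted.
Qed.

Lemma halted_stable i n t t' : halted i n t = true -> (t <= t')%nat ->
  halted i n t' = true /\ result i n t' = result i n t.
Proof. intros H Ht. unfold halted, result in *. now rewrite (state_stable i n t t' H Ht). Qed.

(** Divergence counts as the middle third: the score is then 3 for both outcomes, so the scores of a
    fair bit have mean 3 whether or not program [i] converges. *)
Definition class_of (i : nat) (w : list bool) : nat :=
  match excluded_middle_informative (exists t, halted i (code_bs w) t = true) with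
  | left H => third (result i (code_bs w) (proj1_sig (constructive_indefinite_description _ H)))
  | right _ => 3
  end.

Lemma class_of_halted i w t : halted i (code_bs w) t = true ->
  class_of i w = third (result i (code_bs w) t).
Proof.
  intro H. unfold class_of. destruct excluded_middle_informative as [H'|H']; [|exfalso; eauto].
  destruct constructive_indefinite_description as [s Hs]. cbn [proj1_sig]. f_equal.
  destruct (halted_stable _ _ _ (max s t) H ltac:(lia)) as [_ <-].
  now destruct (halted_stable _ _ _ (max s t) Hs ltac:(lia)) as [_ <-].
Qed.

Lemma third_cases z : third z = 1%nat \/ third z = 3%nat \/ third z = 5%nat.
Proof. unfold third. destruct (_ && _); [destruct (_ <=? _)%nat|]; auto. Qed.

Lemma class_of_cases i w : class_of i w = 1%nat \/ class_of i w = 3%nat \/ class_of i w = 5%nat.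
Proof. unfold class_of. destruct excluded_middle_informative; auto using third_cases. Qed.

Fixpoint total_score (i : nat) (u z : list bool) : nat :=
  match z with
  | [] => 0
  | b :: z => score (class_of i u) b + total_score i (u ++ [b]) z
  end.

Lemma bsum_S_l n g : bsum (S n) g = (g 0 + bsum n (fun m => g (S m)))%nat.
Proof.
  induction n as [|n IH]; [simpl; lia|].
  change (bsum (S (S n)) g) with (bsum (S n) g + g (S n))%nat. rewrite IH. simpl. lia.
Qed.

Lemma bsum_ext n f g : (forall m, (m < n)%nat -> f m = g m) -> bsum n f = bsum n g.
Proof.
  intro H. induction n as [|n IH]; [reflexivity|].
  change (bsum n f + f n = bsum n g + g n)%nat. rewrite IH, H; auto.
Qed.

Lemma total_score_bsum i u z : total_score i u z =
  bsum (length z) (fun m => score (class_of i (firstn (length u + m) (u ++ z)))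
                                  (nth (length u + m) (u ++ z) false)).
Proof.
  revert u. induction z as [|b z IH]; intro u; [reflexivity|].
  cbn [length total_score]. rewrite bsum_S_l, Nat.add_0_r, firstn_length_app, nth_middle. f_equal.
  rewrite IH. apply bsum_ext. intros m _. rewrite <- app_assoc, length_app, <- Nat.add_assoc.
  reflexivity.
Qed.

(* Under fair coin tosses the scores minus 3 are martingale differences bounded by 2. *)
Lemma total_score_variance i n u s :
  mean n (fun z => (s + (INR (total_score i u z) - 3 * INR n)) ^ 2) <= s ^ 2 + 4 * INR n.
Proof.
  revert u s. induction n as [|n IH]; intros u s; [simpl; lra|]. rewrite mean_S, S_INR.
  assert (forall b, mean n (fun z => (s + (INR (total_score i u (b :: z)) - 3 * (INR n + 1))) ^ 2)
    <= (s + (INR (score (class_of i u) b) - 3)) ^ 2 + 4 * INR n) as H.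
  { intro b. eapply Rle_trans; [|apply (IH (u ++ [b]))]. apply Req_le, mean_ext. intros z _.
    cbn [total_score]. rewrite plus_INR. f_equal. lra. }
  pose proof (H false) as H0. pose proof (H true) as H1.
  destruct (class_of_cases i u) as [E|[E|E]]; rewrite E in *; simpl in *; lra.
Qed.

Definition deviates (c : nat) (x : list bool) (k : nat) : Prop := exists u,
  Run c x k u /\ (4 * total_score (task_of k) u (block c k x) < 11 * block_len c k)%nat.

(** An average below 11/4 is a deviation of more than [n / 4] from [3 * n]. The second moment is at
    most [4 * n], and [4n / (n/4)^2 = 64 / n]. *)
Lemma chebyshev i n u : (0 < n)%nat ->
  mean n (fun z => if (4 * total_score i u z <? 11 * n)%nat then 1 else 0) <= 64 / INR n.
Proof.
  intro Hn. apply lt_0_INR in Hn as Hn'.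
  apply Rle_trans with (mean n (fun z =>
    16 / (INR n * INR n) * (0 + (INR (total_score i u z) - 3 * INR n)) ^ 2 + 0 * 0)).
  - apply mean_le. intros z _. set (T := INR (total_score i u z)).
    assert (0 < INR n * INR n) as Hnn by now apply Rmult_lt_0_compat.
    assert (0 <= 16 / (INR n * INR n)) as H16 by (apply Rlt_le, Rdiv_lt_0_compat; lra).
    destruct (Nat.ltb_spec (4 * total_score i u z) (11 * n)) as [H|_].
    + apply lt_INR in H. rewrite !mult_INR in H. fold T in H. simpl in H.
      assert (INR n * INR n <= 16 * (0 + (T - 3 * INR n)) ^ 2) as Hsq by nra.
      apply (Rmult_le_compat_l (/ (INR n * INR n))) in Hsq; [|now apply Rlt_le, Rinv_0_lt_compat].
      rewrite Rinv_l in Hsq by lra. unfold Rdiv. lra.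
    + pose proof (pow2_ge_0 (0 + (T - 3 * INR n))). nra.
  - rewrite (mean_lin _ _ _ _ (fun _ => 0)).
    pose proof (total_score_variance i n u 0) as H.
    assert (0 < 16 / (INR n * INR n)) as H16 by (apply Rdiv_lt_0_compat; nra).
    apply (Rmult_le_compat_l _ _ _ (Rlt_le _ _ H16)) in H.
    replace (64 / INR n) with (16 / (INR n * INR n) * (0 ^ 2 + 4 * INR n)) by (field; lra).
    rewrite mean_const. lra.
Qed.

(** The reserve [1 / start c k] pays for all blocks from stage [k] on: with [N = start c k], block
    [k] costs at most [64 / (255 N)] and the next reserve is [1 / (256 N)], together less than
    [1 / N]. *)
Lemma deviates_small c :
  outer_measure_le (fun al => exists k, deviates c (prefix al (start c (S k))) k) (/ INR (start c 0)).
Proof.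
  set (hit := fun k x => exists j, (j < k)%nat /\ deviates c x j).
  set (V := fun k x => if asbool (hit k x) then 1 else / INR (start c k)).
  assert (forall k, 0 < INR (start c k)) as HN by (intro k; apply lt_0_INR; pose proof (start_gt c k); lia).
  assert (forall k, 0 < / INR (start c k)) as HN' by (intro k; now apply Rinv_0_lt_compat).
  assert (forall j x x', firstn (start c (S j)) x = firstn (start c (S j)) x' ->
    deviates c x j -> deviates c x' j) as Ed.
  { intros j x x' E (u & Hu & Hd). exists u. rewrite <- (block_ext c j x x' E). split; [|exact Hd].
    revert Hu. apply Run_ext. apply (firstn_le x x' (start c j) (start c (S j))); [apply start_mono; lia|exact E]. }
  apply (outer_measure_le_mono _ (fun al => exists k, 1 <= V k (prefix al (start c k))) (/ INR (start c 0))
    _); [|lra|].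
  - intros al (k & H). exists (S k). unfold V. rewrite (proj2 (asbool_iff (hit _ _))) by (exists k; auto).
    lra.
  - apply outer_measure_le_stages.
    + intros k x. unfold V. specialize (HN' k). destruct (asbool (hit k x)); lra.
    + intros k x Hx.
      assert (forall z j, (j < k)%nat -> deviates c (x ++ z) j -> deviates c x j) as Ez.
      { intros z j Hj. apply Ed, firstn_app_le. rewrite Hx. now apply start_mono. }
      unfold V at 2. destruct (asbool (hit k x)) eqn:Hh.
      * rewrite <- (mean_const (block_len c k) 1). apply mean_le. intros z _. unfold V.
        destruct (asbool (hit (S k) (x ++ z))); [lra|].
        rewrite <- Rinv_1. apply Rinv_le_contravar; [lra|]. apply (le_INR 1).
        pose proof (start_gt c (S k)). lia.
      * assert (~ hit k x) as Hn by (intro Hi; apply (proj2 (asbool_iff _)) in Hi; congruence).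
        assert (0 < block_len c k)%nat as Hlen by (rewrite block_len_eq; pose proof (start_gt c k); lia).
        (* At most one [u] is the output after [k] stages, so the event is a condition on [z] alone.
           If there is none, the event is empty and any [u] will do. *)
        assert (exists u, forall z, length z = block_len c k -> deviates c (x ++ z) k ->
          (4 * total_score (task_of k) u z < 11 * block_len c k)%nat) as [u Hu].
        { destruct (excluded_middle_informative (exists u, Run c x k u)) as [[u Ru]|Nu].
          - exists u. intros z Hz (u' & Ru' & Hd).
            assert (Run c x k u') as Ru''.
            { revert Ru'. apply Run_ext, firstn_app_le. lia. }
            rewrite (Run_fun _ _ _ _ _ Ru Ru''). unfold block in Hd.
            rewrite <- Hx, skipn_app, skipn_all, Nat.sub_diag in Hd. simpl app in Hd.
            rewrite firstn_all2 in Hd by lia. exact Hd.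
          - exists []. intros z Hz (u' & Ru' & _). exfalso. apply Nu. exists u'.
            revert Ru'. apply Run_ext, firstn_app_le. lia. }
        apply Rle_trans with (mean (block_len c k) (fun z =>
          1 * (if (4 * total_score (task_of k) u z <? 11 * block_len c k)%nat then 1 else 0)
          + / INR (start c (S k)) * 1)).
        -- apply mean_le. intros z Hz. unfold V. specialize (HN' (S k)).
           destruct (asbool (hit (S k) (x ++ z))) eqn:E.
           ++ apply (proj1 (asbool_iff _)) in E. destruct E as (j & Hj & Hd).
              destruct (Nat.eq_dec j k) as [->|].
              ** apply Hu in Hd; [|exact Hz]. apply Nat.ltb_lt in Hd. rewrite Hd. lra.
              ** exfalso. apply Hn. exists j. split; [lia|]. apply (Ez z); [lia|exact Hd].
           ++ destruct (_ <? _)%nat; lra.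
        -- rewrite (mean_lin _ _ _ _ (fun _ => 1)), mean_const.
           pose proof (chebyshev (task_of k) (block_len c k) u Hlen) as Hc.
           assert (INR (block_len c k) = 255 * INR (start c k)) as El.
           { rewrite block_len_eq, mult_INR. f_equal. simpl. lra. }
           assert (INR (start c (S k)) = 256 * INR (start c k)) as ->.
           { rewrite start_S, mult_INR. f_equal. simpl. lra. }
           rewrite El in Hc. specialize (HN k).
           rewrite Rinv_mult. unfold Rdiv in Hc. rewrite Rinv_mult in Hc. specialize (HN' k). lra.
    + intros x _. unfold V. destruct (asbool (hit 0%nat x)) eqn:E; [|lra].
      apply (proj1 (asbool_iff _)) in E. destruct E as (j & Hj & _). lia.
Qed.

Definition good (c : nat) (al : seqb) : Prop :=
  (forall i, ~ lost c i al) /\ (forall k, ~ deviates c (prefix al (start c (S k))) k) /\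
  forall i K, ~ never_held c i K al.

(** The factor 3 collects [2 * 2^-c] from the geometric series over all programs and
    [256^-c <= 2^-c] from the deviating blocks; the events [never_held] are null. *)
Lemma good_likely c : (1 <= c)%nat -> outer_measure_le (fun al => ~ good c al) (3 * (/ 2) ^ c).
Proof.
  intro Hc. pose proof (half_pow_bounds c) as Hp.
  assert (/ INR (start c 0) <= (/ 2) ^ c) as H0.
  { rewrite pow_inv. apply Rinv_le_contravar; [apply pow_lt; lra|].
    rewrite start_0, pow_INR. apply pow_incr. simpl. lra. }
  apply (outer_measure_le_mono _ (fun al => (exists i, lost c i al) \/
    ((exists k, deviates c (prefix al (start c (S k))) k) \/
     exists n, never_held c (pfst n) (psnd n) al)) (2 * (/ 2) ^ c + ((/ 2) ^ c + 0))).
  - intros al H. apply NNPP. intro H'. apply H. repeat split.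
    + intros i Hi. apply H'. eauto.
    + intros k Hk. apply H'. eauto.
    + intros i K HK. apply H'. right. right. exists (to_nat (i, K)).
      now rewrite pfst_to_nat, psnd_to_nat.
  - lra.
  - apply outer_measure_le_or; [| |lra..].
    + apply (outer_measure_le_union _ (fun i => (/ 2) ^ (i + c))); [apply lost_small|].
      intro N. assert (sum_f_R0 (fun i => (/ 2) ^ (i + c)) N = (2 - (/ 2) ^ N) * (/ 2) ^ c) as ->.
      { induction N as [|N IH]; [simpl; lra|]. rewrite tech5, IH, pow_add. simpl. lra. }
      pose proof (half_pow_bounds N). nra.
    + apply outer_measure_le_or; [| |lra..].
      * apply (outer_measure_le_mono _ _ _ _ (fun _ H => H) H0), deviates_small.
      * apply (outer_measure_le_union _ (fun _ => 0)); [intro; now apply never_held_null|].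
        intro N. rewrite sum_eq_R0; [lra|reflexivity].
Qed.

(** * Outputs on good inputs *)

Definition path (c : nat) (al om : seqb) : Prop :=
  forall k, Run c (prefix al (start c k)) k (prefix om (start c k)).

Lemma prefix_start_S c al k : firstn (start c k) (prefix al (start c (S k))) = firstn (start c k) (prefix al (start c k)).
Proof. now rewrite !firstn_prefix by (apply start_mono; lia). Qed.

Lemma Run_prefix_start c al j k y : (j <= k)%nat -> Run c (prefix al (start c k)) j y -> Run c (prefix al (start c j)) j y.
Proof. intro H. apply Run_ext. now rewrite !firstn_prefix by (apply start_mono; lia). Qed.

Lemma path_exists c al : (forall i, ~ lost c i al) -> exists om, path c al om.
Proof.
  intro Hl.
  assert (forall k, exists y, Run c (prefix al (start c k)) k y) as HY.
  { induction k as [|k [u Hu]]; [eexists; reflexivity|].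
    assert (Run c (prefix al (start c (S k))) k u) as Hu'.
    { revert Hu. apply Run_ext. now rewrite prefix_start_S. }
    enough (exists y, Stage c (prefix al (start c (S k))) k u y) as [y Hy] by (exists y, u; auto).
    unfold Stage. destruct (att c u k && hold c k (prefix al (start c (S k)))) eqn:E; [|eauto].
    apply Bool.andb_true_iff in E. destruct E as [E1 E2].
    destruct (excluded_middle_informative (exists p, ok c (task_of k) k u p = true)) as [[p Hp]|Hn].
    - apply exists_least in Hp. destruct Hp as [q Hq]. eexists. exists q. split; [|reflexivity].
      now apply leastok_iff.
    - exfalso. apply (Hl (task_of k)). exists k. split; [|exact E2]. split; [reflexivity|]. eauto. }
  set (Y := fun k => proj1_sig (constructive_indefinite_description _ (HY k))).
  assert (forall k, Run c (prefix al (start c k)) k (Y k)) as RY.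
  { intro k. exact (proj2_sig (constructive_indefinite_description _ (HY k))). }
  assert (forall j k, (j <= k)%nat -> firstn (start c j) (Y k) = Y j) as EY.
  { intros j k H. apply (Run_fun c (prefix al (start c j)) j); [|apply RY].
    apply (Run_prefix_start c al j k _ H). apply (Run_firstn c _ j k); auto. now rewrite length_prefix. }
  (* [n < start c n], so the output after [n] stages already contains position [n]. *)
  exists (fun n => nth n (Y n) false). intro k.
  replace (prefix (fun n => nth n (Y n) false) (start c k)) with (Y k); [apply RY|].
  assert (length (Y k) = start c k) as L by (apply (Run_length c (prefix al (start c k)) k); [now rewrite length_prefix|auto]).
  apply list_eq_nth; rewrite L; [now rewrite length_prefix|]. intros n Hn. rewrite nth_prefix by exact Hn.
  pose proof (start_gt c n). destruct (Nat.le_ge_cases n k) as [H1|H1].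
  - rewrite <- (EY n k H1), nth_firstn, (proj2 (Nat.ltb_lt _ _)); [reflexivity|lia].
  - rewrite <- (EY k n H1), nth_firstn, (proj2 (Nat.ltb_lt _ _)); [reflexivity|lia].
Qed.

Lemma path_output c al om : path c al om -> op_output_inf (Fhat c) al om.
Proof.
  intro HP. split.
  - intros x y Hx Hy. apply Fhat_iff in Hy. destruct Hy as [->|(k & z & Hk & Hz & E)]; [reflexivity|].
    unfold prefix_of in *.
    assert (Run c (prefix al (start c k)) k z) as Hz'.
    { revert Hz. apply Run_ext. rewrite Hx, !firstn_prefix by lia. reflexivity. }
    rewrite (Run_fun _ _ _ _ _ Hz' (HP k)) in E.
    assert (length y <= start c k)%nat as L.
    { rewrite <- E, length_firstn, length_prefix. lia. }
    now rewrite firstn_prefix in E.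
  - intro n. exists (prefix al (start c n)), (prefix om (start c n)). pose proof (start_gt c n).
    rewrite length_prefix. split; [unfold prefix_of; now rewrite length_prefix|]. split; [|lia].
    apply Fhat_iff. right. exists n, (prefix om (start c n)). rewrite !length_prefix.
    repeat split; [lia|apply HP|]. now apply firstn_prefix.
Qed.

Lemma path_Stage c al om k : path c al om ->
  Stage c (prefix al (start c (S k))) k (prefix om (start c k)) (prefix om (start c (S k))).
Proof.
  intro HP. pose proof (start_mono c k (S k) ltac:(lia)).
  pose proof (Run_step c (prefix al (start c (S k))) k (S k) (prefix om (start c (S k))) ltac:(lia)) as Hs.
  rewrite length_prefix, !firstn_prefix in Hs by lia. apply Hs; [lia|apply HP].
Qed.

Definition block_score (c i : nat) (om : seqb) (k : nat) : nat :=
  bsum (block_len c k) (fun m => score (class_of i (prefix om (start c k + m))) (om (start c k + m)%nat)).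

Definition converges_on (i : nat) (om : seqb) : Prop :=
  forall n, exists t, halted i (code_bs (prefix om n)) t = true.

Lemma ok_of_score c i om k : converges_on i om -> (11 * block_len c k <= 4 * block_score c i om k)%nat ->
  exists p, ok c i k (prefix om (start c k)) p = true.
Proof.
  intros Hc Hs.
  assert (exists T, forall m, (m < block_len c k)%nat ->
    halted i (code_bs (prefix om (start c k + m))) T = true) as [T HT].
  { generalize (block_len c k) as n. induction n as [|n [T HT]]; [exists 0%nat; lia|].
    destruct (Hc (start c k + n)%nat) as [t Ht]. exists (max t T). intros m Hm.
    destruct (Nat.eq_dec m n) as [->|].
    - apply (halted_stable _ _ t); [exact Ht|lia].
    - apply (halted_stable _ _ T); [apply HT|]; lia. }
  (* The appended zeros raise the code, which is also the time bound, above [T] and leave the block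
     unchanged. *)
  set (l := prefix om (start c (S k)) ++ repeat false T). exists (code_bs l).
  assert (T <= code_bs l)%nat as Hp.
  { pose proof (length_dec (code_bs l)) as H. rewrite dec_code in H. unfold l at 1 in H.
    rewrite length_app, repeat_length in H. lia. }
  assert (forall n, (n <= start c (S k))%nat -> firstn n l = prefix om n) as Ef.
  { intros n Hn. unfold l. rewrite firstn_app_le by (rewrite length_prefix; lia).
    now apply firstn_prefix. }
  pose proof (start_block_len c k) as HN.
  unfold ok. rewrite dec_code, !Bool.andb_true_iff, Nat.leb_le, bs_eqb_iff, ball_iff, Nat.leb_le.
  repeat split.
  - unfold l. rewrite length_app, length_prefix. lia.
  - apply Ef. lia.
  - intros m Hm. rewrite Ef by lia. apply (halted_stable _ _ T); auto.
  - eapply Nat.le_trans; [exact Hs|]. apply Nat.eq_le_incl. f_equal. apply bsum_ext. intros m Hm.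
    rewrite Ef by lia. f_equal.
    + apply class_of_halted. apply (halted_stable _ _ T); auto.
    + unfold l. rewrite app_nth1 by (rewrite length_prefix; lia). rewrite nth_prefix by lia.
      reflexivity.
Qed.

Lemma score_of_ok c i om k p : ok c i k (prefix om (start c k)) p = true ->
  prefix om (start c (S k)) = firstn (start c (S k)) (dec p) ->
  (11 * block_len c k <= 4 * block_score c i om k)%nat.
Proof.
  unfold ok. rewrite !Bool.andb_true_iff, ball_iff, !Nat.leb_le. intros [[_ Hh] Hs] E.
  pose proof (start_block_len c k) as HN.
  assert (forall n, (n <= start c (S k))%nat -> firstn n (dec p) = prefix om n) as Ef.
  { intros n Hn. rewrite <- (firstn_prefix om n (start c (S k)) Hn), E.
    now rewrite firstn_firstn, Nat.min_l. }
  eapply Nat.le_trans; [exact Hs|]. apply Nat.eq_le_incl. f_equal. apply bsum_ext. intros m Hm.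
  rewrite Ef by lia. f_equal.
  - symmetry. apply class_of_halted. rewrite <- Ef by lia. now apply Hh.
  - rewrite <- (nth_prefix om (start c (S k))), E, nth_firstn by lia.
    now rewrite (proj2 (Nat.ltb_lt _ _)) by lia.
Qed.

(** This covers every stage of the program, attempted or not, and so also makes the selection rules
    defined along all of [om]. *)
Lemma stages_resolved c al om k : good c al -> path c al om -> converges_on (task_of k) om ->
  exists p, ok c (task_of k) k (prefix om (start c k)) p = true.
Proof.
  intros (_ & Hd & _) HP Hc. pose proof (path_Stage c al om k HP) as Hs. unfold Stage in Hs.
  destruct (_ && _).
  - destruct Hs as (p & Hp & _). apply leastok_iff in Hp. exists p. tauto.
  - apply ok_of_score; [exact Hc|].
    destruct (Nat.le_gt_cases (11 * block_len c k) (4 * block_score c (task_of k) om k)) as [|H]; [assumption|].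
    exfalso. apply (Hd k). exists (prefix om (start c k)). split.
    + generalize (HP k). apply Run_ext. now rewrite prefix_start_S.
    + rewrite total_score_bsum, length_block, length_prefix, <- Hs by (rewrite length_prefix; lia).
      eapply Nat.le_lt_trans; [|exact H]. apply Nat.eq_le_incl. f_equal. apply bsum_ext.
      intros m Hm. pose proof (start_block_len c k). now rewrite firstn_prefix, nth_prefix by lia.
Qed.

Lemma path_attempted c al om k : path c al om ->
  attempted c (task_of k) (prefix al (start c k)) k <-> att c (prefix om (start c k)) k = true.
Proof.
  intro HP. split.
  - intros (_ & u & Hu & Ha). now rewrite (Run_fun _ _ _ _ _ (HP k) Hu).
  - intro Ha. split; [reflexivity|]. exists (prefix om (start c k)). split; [apply HP|exact Ha].
Qed.

(** If no attempt came after [K], the finitely many earlier ones would all be resolved within some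
    bound [B], and a stage of [i] beyond both [K] and [B] would be unblocked. *)
Lemma infinitely_many_attempts c al om i : good c al -> path c al om -> converges_on i om ->
  forall K, exists k, (K <= k)%nat /\ attempted c i (prefix al (start c k)) k.
Proof.
  intros Hg HP Hc K. apply NNPP. intro Hn.
  assert (exists B, forall j, (j < K)%nat -> task_of j = i ->
    exists p, (p <= B)%nat /\ ok c i j (prefix om (start c j)) p = true) as [B HB].
  { clear Hn. induction K as [|K [B HB]]; [exists 0%nat; lia|].
    destruct (Nat.eq_dec (task_of K) i) as [<-|E].
    - destruct (stages_resolved c al om K Hg HP Hc) as [p Hp]. exists (max p B). intros j Hj T.
      destruct (Nat.eq_dec j K) as [->|]; [exists p; split; [lia|exact Hp]|].
      destruct (HB j ltac:(lia) T) as (q & Hq & Ho). exists q. split; [lia|exact Ho].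
    - exists B. intros j Hj T. apply HB; [|exact T]. destruct (Nat.eq_dec j K) as [->|]; [tauto|lia]. }
  (* A pairing code is at least the sum of its components, so this stage of [i] has index at least
     [K + B]. *)
  set (k := to_nat (i, K + B)%nat).
  assert (task_of k = i) as Tk by apply pfst_to_nat.
  pose proof (to_nat_non_decreasing i (K + B)) as Hk. fold k in Hk.
  apply Hn. exists k. split; [lia|]. rewrite <- Tk. apply (path_attempted c al om k HP).
  apply att_iff. intros j Hj Tj Aj. rewrite Tk in Tj.
  rewrite (att_ext c _ (prefix om (start c j))) in Aj
    by (rewrite !firstn_prefix by (apply start_mono; lia); reflexivity).
  apply (path_attempted c al om j HP) in Aj. rewrite Tj in *.
  destruct (Nat.lt_ge_cases j K) as [HjK|HjK]; [|exfalso; apply Hn; eauto].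
  destruct (HB j HjK Tj) as (p & Hp & Ho). exists p. split; [lia|].
  rewrite firstn_prefix by (apply start_mono; lia). exact Ho.
Qed.

Definition diagonal (c i : nat) (om : seqb) (k p : nat) : Prop :=
  task_of k = i /\ leastok c i k (prefix om (start c k)) p = true /\
  prefix om (start c (S k)) = firstn (start c (S k)) (dec p).

Lemma infinitely_many_diagonal c al om i : good c al -> path c al om -> converges_on i om ->
  forall K, exists k p, (K <= k)%nat /\ diagonal c i om k p.
Proof.
  intros Hg HP Hc K. pose proof (infinitely_many_attempts c al om i Hg HP Hc) as Ha.
  assert (exists k, (K <= k)%nat /\ attempted c i (prefix al (start c k)) k /\
    hold c k (prefix al (start c (S k))) = true) as (k & Hk & Hat & Hh).
  { apply NNPP. intro Hn. destruct Hg as (_ & _ & Hg). apply (Hg i K). split; [exact Ha|].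
    intros k Hk Hat. apply Bool.not_true_iff_false. intro Hh. apply Hn. eauto. }
  pose proof (proj1 Hat) as T. rewrite <- T in Hat. apply (path_attempted c al om k HP) in Hat.
  pose proof (path_Stage c al om k HP) as Hs. unfold Stage in Hs. rewrite Hat, Hh in Hs.
  destruct Hs as (p & Hp & E). exists k, p. split; [exact Hk|]. rewrite T in Hp. repeat split; auto.
Qed.

(** * Selection rules *)

Definition in_stage (c i k n : nat) : bool :=
  (start c k <=? n)%nat && (n <? start c (S k))%nat && (task_of k =? i)%nat.

Definition select_ready (c i : nat) (x : list bool) (p : nat) : bool :=
  ball (S (length x)) (fun k => implb (in_stage c i k (length x)) (ok c i k (firstn (start c k) x) p)).

(** The rule cannot tell whether a block was held. It repeats the search in every stage of [i] and
    selects only while the string found agrees with the past. What it selects in copied blocks is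
    harmless, as the next diagonal block outweighs the whole past. *)
Definition select_value (c i : nat) (b : bool) (x : list bool) (p : nat) : bool :=
  bex (S (length x)) (fun k => in_stage c i k (length x)) &&
  bs_eqb (firstn (length x) (dec p)) x && Bool.eqb (nth (length x) (dec p) false) b.

Lemma in_stage_iff c i k n : in_stage c i k n = true <-> (start c k <= n < start c (S k))%nat /\ task_of k = i.
Proof. unfold in_stage. rewrite !Bool.andb_true_iff, Nat.leb_le, Nat.ltb_lt, Nat.eqb_eq. tauto. Qed.

Lemma in_stage_unique c i j k n : in_stage c i j n = true -> in_stage c i k n = true -> j = k.
Proof.
  rewrite !in_stage_iff. intros [H _] [H' _].
  destruct (Nat.lt_trichotomy j k) as [L|[L|L]]; auto.
  - pose proof (start_mono c (S j) k L). lia.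
  - pose proof (start_mono c (S k) j L). lia.
Qed.

Lemma select_ready_iff c i k x p : in_stage c i k (length x) = true ->
  select_ready c i x p = ok c i k (firstn (start c k) x) p.
Proof.
  intro H. unfold select_ready. apply Bool.eq_iff_eq_true. rewrite ball_iff. split.
  - intro H'. specialize (H' k). rewrite H in H'. apply H'. apply in_stage_iff in H.
    pose proof (start_gt c k). lia.
  - intros H' j _. destruct (in_stage c i j (length x)) eqn:E; [|reflexivity].
    now rewrite (in_stage_unique c i j k _ E H).
Qed.

Lemma selection_rule_exists c i b : exists d, computable_selection d /\
  forall x p, select_ready c i x p = true -> (forall q, (q < p)%nat -> select_ready c i x q = false) ->
  d x = Some (select_value c i b x p).
Proof.
  apply selection_exists.
  - unfold select_ready, in_stage, task_of. comp.
    apply (CompB_ok c 3 (fun _ => i) (fun v => nth 0 v 0%nat)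
      (fun v => firstn (start c (nth 0 v 0%nat)) (dec (nth 1 (tl v) 0%nat))) (fun v => nth 0 (tl v) 0%nat)); comp.
  - unfold select_value, in_stage, task_of. comp.
Qed.

Lemma rule_on_path c al om i b d : good c al -> path c al om -> converges_on i om ->
  (forall x p, select_ready c i x p = true -> (forall q, (q < p)%nat -> select_ready c i x q = false) ->
     d x = Some (select_value c i b x p)) ->
  (forall n, d (prefix om n) <> None) /\
  (forall k p m, diagonal c i om k p -> (m < block_len c k)%nat ->
     d (prefix om (start c k + m)) = Some (Bool.eqb (om (start c k + m)%nat) b)).
Proof.
  intros Hg HP Hc Hd. split.
  - intro n. assert (exists p, select_ready c i (prefix om n) p = true) as [p Hp].
    { destruct (excluded_middle_informative (exists k, in_stage c i k n = true)) as [[k Hk]|Hn].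
      - pose proof Hk as Hk'. apply in_stage_iff in Hk'. destruct Hk' as [Hk' T].
        rewrite <- T in Hc. destruct (stages_resolved c al om k Hg HP Hc) as [p Hp]. exists p.
        rewrite (select_ready_iff c i k) by now rewrite length_prefix.
        rewrite firstn_prefix by lia. now rewrite <- T.
      (* Outside the stages of [i], [select_ready] holds vacuously and the rule answers at once. *)
      - exists 0%nat. apply ball_iff. intros k _. rewrite length_prefix.
        destruct (in_stage c i k n) eqn:E; [|reflexivity]. exfalso. eauto. }
    apply exists_least in Hp. destruct Hp as (q & Hq & Hq'). rewrite (Hd _ q Hq Hq'). discriminate.
  - intros k p m (T & Hp & E) Hm. pose proof (start_block_len c k) as HN. set (n := (start c k + m)%nat).
    assert (in_stage c i k (length (prefix om n)) = true) as Hst.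
    { apply in_stage_iff. rewrite length_prefix. split; [lia|exact T]. }
    assert (forall q, select_ready c i (prefix om n) q = ok c i k (prefix om (start c k)) q) as Hr.
    { intro q. rewrite (select_ready_iff c i k) by exact Hst. now rewrite firstn_prefix by lia. }
    apply leastok_iff in Hp. destruct Hp as [Hp Hp'].
    rewrite (Hd _ p) by (intros; rewrite Hr; auto). f_equal. unfold select_value.
    rewrite (proj2 (bex_iff _ _)).
    2:{ exists k. split; [|exact Hst]. rewrite length_prefix. pose proof (start_gt c k). lia. }
    rewrite length_prefix.
    assert (firstn n (dec p) = prefix om n) as ->.
    { rewrite <- (firstn_prefix om n (start c (S k))), E by lia. now rewrite firstn_firstn, Nat.min_l by lia. }
    rewrite bs_eqb_refl. cbn [andb]. f_equal.
    rewrite <- (nth_prefix om (start c (S k)) n), E, nth_firstn by lia.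
    now rewrite (proj2 (Nat.ltb_lt _ _)) by lia.
Qed.

(** * The forecasting error *)

(** [sum_f_R0] includes its upper index; an exclusive bound splits cleanly where a block starts. *)
Fixpoint rsum (n : nat) (g : nat -> R) : R :=
  match n with O => 0 | S n => rsum n g + g n end.

Lemma sum_f_R0_rsum g n : sum_f_R0 g n = rsum (S n) g.
Proof. induction n as [|n IH]; [simpl; lra|]. rewrite tech5, IH. reflexivity. Qed.

Lemma rsum_add m n g : rsum (m + n) g = rsum m g + rsum n (fun j => g (m + j)%nat).
Proof.
  induction n as [|n IH]; [rewrite Nat.add_0_r; simpl; lra|]. rewrite Nat.add_succ_r. simpl.
  rewrite IH. lra.
Qed.

Lemma rsum_abs_le n g : (forall j, Rabs (g j) <= 1) -> Rabs (rsum n g) <= INR n.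
Proof.
  intro H. induction n as [|n IH]; [simpl; rewrite Rabs_R0; lra|]. rewrite S_INR. simpl.
  pose proof (Rabs_triang (rsum n g) (g n)). specialize (H n). lra.
Qed.

Lemma rsum_ext n g h : (forall j, (j < n)%nat -> g j = h j) -> rsum n g = rsum n h.
Proof. intro H. induction n as [|n IH]; simpl; [reflexivity|]. rewrite IH, H; auto. Qed.

(** The approximating rational may leave [0, 1], and the outer thirds absorb it: since [v] itself
    lies in [0, 1], the distance to the midpoint is still controlled. *)
Lemma third_approx z v : 0 <= v <= 1 -> Rabs (rat_of_nat z - v) <= / 100 ->
  Rabs (v - INR (third z) / 6) <= 1 / 6 + / 100.
Proof.
  intros Hv Hz. unfold rat_of_nat in Hz. unfold third.
  rewrite (surjective_pairing (of_nat z)) in Hz. fold (pfst z) (psnd z) in Hz.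
  rewrite (surjective_pairing (of_nat (psnd z))) in Hz. fold (pfst (psnd z)) (psnd (psnd z)) in Hz.
  rewrite Nat.negb_odd. set (p := pfst (psnd z)) in *. set (q := psnd (psnd z)) in *.
  pose proof (pos_INR p) as Hp. pose proof (lt_0_INR (S q) ltac:(lia)) as Hq.
  assert (0 <= INR p / INR (S q)) as Hr by (apply Rmult_le_pos; [lra|apply Rlt_le, Rinv_0_lt_compat, Hq]).
  set (r := INR p / INR (S q)) in *.
  assert (INR p = r * INR (S q)) as Ep by (unfold r; field; lra).
  assert (forall a : nat, (a * S q <=? 3 * p)%nat = true -> INR a / 3 <= r) as Hle.
  { intros a H%Nat.leb_le. apply le_INR in H. rewrite !mult_INR, Ep in H.
    replace (INR 3) with 3 in H by (simpl; lra).
    apply (Rmult_le_reg_r (INR (S q))); lra. }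
  assert (forall a : nat, (a * S q <=? 3 * p)%nat = false -> r <= INR a / 3) as Hge.
  { intros a H%Nat.leb_gt. apply lt_INR in H. rewrite !mult_INR, Ep in H.
    replace (INR 3) with 3 in H by (simpl; lra).
    apply (Rmult_le_reg_r (INR (S q))); lra. }
  assert (- / 100 <= (if Nat.even (pfst z) then 1 else -1) * r - v <= / 100) as Hz'.
  { revert Hz. unfold Rabs. destruct (Rcase_abs _); lra. }
  clear Hz. apply Rabs_le.
  destruct (Nat.even (pfst z)); cbn [andb].
  - pose proof (Hle 1%nat) as H1. pose proof (Hge 1%nat) as H1'. rewrite Nat.mul_1_l in H1, H1'.
    pose proof (Hle 2%nat) as H2. pose proof (Hge 2%nat) as H2'.
    destruct (S q <=? 3 * p)%nat; [destruct (2 * S q <=? 3 * p)%nat|]; simpl INR in *;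
      repeat match goal with H : true = true -> _ |- _ => specialize (H eq_refl)
             | H : false = false -> _ |- _ => specialize (H eq_refl) end; lra.
  - simpl INR. lra.
Qed.

Lemma rat_pos_precision : rat_pos_of_nat precision = / 100.
Proof.
  unfold rat_pos_of_nat, precision. rewrite cancel_of_to. simpl (INR 1). 
  replace (INR 100) with 100 by (rewrite INR_IZR_INZ; reflexivity). lra.
Qed.

Lemma machine_halts cf n y : eval cf [n; precision] y ->
  exists t, halted (enc cf) n t = true /\ result (enc cf) n t = y.
Proof.
  intro H. destruct (proj1 machine_complete _ _ _ H 0%nat 0%nat) as [t Ht].
  exists t. unfold halted, result, state. cbn [nlist fold_right] in Ht. rewrite Ht.
  rewrite pfst_to_nat, psnd_to_nat, nhd_ncons. auto.
Qed.

Lemma forecast_class f fv om : pdfa f -> (forall n, f (prefix om n) = Some (fv n)) ->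
  exists i, converges_on i om /\
    forall n, 0 <= fv n <= 1 /\ Rabs (fv n - INR (class_of i (prefix om n)) / 6) <= 1 / 6 + / 100.
Proof.
  intros [Hf (cf & H1 & H2)] Hv. exists (enc cf).
  assert (forall n, exists t z, halted (enc cf) (code_bs (prefix om n)) t = true /\
    result (enc cf) (code_bs (prefix om n)) t = z /\ Rabs (rat_of_nat z - fv n) <= / 100) as H.
  { intro n. assert (halts cf [code_bs (prefix om n); precision]) as [z Hz].
    { apply H1. rewrite Hv. discriminate. }
    destruct (machine_halts _ _ _ Hz) as (t & Ht & Hr). exists t, z. repeat split; auto.
    rewrite <- rat_pos_precision. now apply (H2 (prefix om n)). }
  split.
  - intro n. destruct (H n) as (t & _ & Ht & _). eauto.
  - intro n. specialize (Hf _ _ (Hv n)). split; [exact Hf|]. destruct (H n) as (t & z & Ht & Hr & Hz).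
    rewrite (class_of_halted _ _ t Ht), Hr. now apply third_approx.
Qed.

Lemma score_dist a b v : (a = 1 \/ a = 3 \/ a = 5)%nat -> 0 <= v <= 1 ->
  Rabs (v - INR a / 6) <= 1 / 6 + / 100 ->
  INR (score a b) / 6 - (1 / 6 + / 100) <= b2R b * (1 - v) + (1 - b2R b) * v.
Proof.
  intros Ha Hv H.
  assert (- (1 / 6 + / 100) <= v - INR a / 6 <= 1 / 6 + / 100) as H'.
  { revert H. unfold Rabs. destruct (Rcase_abs _); lra. }
  destruct Ha as [-> | [-> | ->]], b; simpl in *; lra.
Qed.

Lemma block_error c i om fv k : (forall n, 0 <= fv n <= 1 /\
    Rabs (fv n - INR (class_of i (prefix om n)) / 6) <= 1 / 6 + / 100) ->
  INR (block_score c i om k) / 6 - INR (block_len c k) * (1 / 6 + / 100) <=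
  rsum (block_len c k) (fun m => b2R (om (start c k + m)%nat) * (1 - fv (start c k + m)%nat)) +
  rsum (block_len c k) (fun m => (1 - b2R (om (start c k + m)%nat)) * fv (start c k + m)%nat).
Proof.
  intro H. unfold block_score. induction (block_len c k) as [|n IH]; [simpl; lra|].
  change (bsum (S n) ?g) with (bsum n g + g n)%nat. rewrite plus_INR, S_INR. simpl rsum.
  destruct (H (start c k + n)%nat) as [H1 H2].
  pose proof (score_dist _ (om (start c k + n)%nat) _ (class_of_cases i _) H1 H2). lra.
Qed.

Lemma diagonal_error c i om fv k p (dv : bool -> nat -> bool) :
  (forall n, 0 <= fv n <= 1 /\
     Rabs (fv n - INR (class_of i (prefix om n)) / 6) <= 1 / 6 + / 100) ->
  diagonal c i om k p ->
  (forall b m, (m < block_len c k)%nat -> dv b (start c k + m)%nat = Bool.eqb (om (start c k + m)%nat) b) ->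
  exists b, 1 / 8 <= Rabs (/ INR (start c (S k)) *
    rsum (start c (S k)) (fun j => b2R (dv b j) * (b2R (om j) - fv j))).
Proof.
  intros Hfv (T & Hp & E) Hdv. apply leastok_iff in Hp. destruct Hp as [Hp _].
  pose proof (score_of_ok c i om k p Hp E) as Hs.
  pose proof (block_error c i om fv k Hfv) as Hb.
  set (A1 := rsum (block_len c k) (fun m => b2R (om (start c k + m)%nat) * (1 - fv (start c k + m)%nat))) in Hb.
  set (A0 := rsum (block_len c k) (fun m => (1 - b2R (om (start c k + m)%nat)) * fv (start c k + m)%nat)) in Hb.
  apply le_INR in Hs. rewrite !mult_INR in Hs.
  replace (INR 11) with 11 in Hs by (simpl; lra). replace (INR 4) with 4 in Hs by (simpl; lra).
  assert (0 < INR (start c k)) as HN by (apply lt_0_INR; pose proof (start_gt c k); lia).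
  assert (INR (block_len c k) = 255 * INR (start c k)) as El.
  { rewrite block_len_eq, mult_INR. f_equal. simpl. lra. }
  assert (INR (start c (S k)) = 256 * INR (start c k)) as EN.
  { rewrite start_S, mult_INR. f_equal. simpl. lra. }
  rewrite El in *.
  assert (forall b, Rabs (rsum (start c k) (fun j => b2R (dv b j) * (b2R (om j) - fv j))) <= INR (start c k)) as Hpast.
  { intro b. apply rsum_abs_le. intro j. destruct (Hfv j) as [Hj _]. apply Rabs_le.
    destruct (dv b j), (om j); simpl; lra. }
  (* With [N = INR (start c k)], [A1 + A0] is at least [255 (11/24 - 1/6 - 1/100) N], which is more
     than [71 N], so one of them is at least [33 N]. The past takes away at most [N], and
     [32 N / (256 N) = 1/8]. *)
  assert (exists b, 33 * INR (start c k) <= Rabs (rsum (block_len c k)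
    (fun m => b2R (dv b (start c k + m)%nat) * (b2R (om (start c k + m)%nat) - fv (start c k + m)%nat)))) as [b HA].
  { destruct (Rle_dec (33 * INR (start c k)) A1) as [H1|H1].
    - exists true. eapply Rle_trans; [exact H1|]. eapply Rle_trans; [apply Rle_abs|].
      apply Req_le. f_equal. apply rsum_ext. intros m Hm. rewrite Hdv by exact Hm.
      destruct (om _); simpl; lra.
    - exists false. apply Rle_trans with A0; [lra|]. eapply Rle_trans; [apply Rle_abs|].
      rewrite <- Rabs_Ropp. apply Req_le. f_equal.
      assert (forall n g, - rsum n g = rsum n (fun j => - g j)) as Hopp.
      { clear. induction n as [|n IH]; intro g; simpl; [lra|]. rewrite <- IH. lra. }
      unfold A0. rewrite Hopp. apply rsum_ext. intros m Hm. rewrite Hdv by exact Hm.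
      destruct (om _); simpl; lra. }
  exists b. rewrite Rabs_mult, EN, Rabs_right by (apply Rle_ge, Rlt_le, Rinv_0_lt_compat; lra).
  rewrite start_block_len, rsum_add.
  specialize (Hpast b).
  match goal with |- _ <= _ * Rabs (?x + ?y) => 
    assert (32 * INR (start c k) <= Rabs (x + y)) as Hsum;
    [pose proof (Rabs_triang (x + y) (- x)) as Ht; rewrite Rabs_Ropp in Ht;
     replace (x + y + - x) with y in Ht by lra; lra|] end.
  apply (Rmult_le_compat_l (/ (256 * INR (start c k)))) in Hsum;
    [|apply Rlt_le, Rinv_0_lt_compat; lra].
  replace (/ (256 * INR (start c k)) * (32 * INR (start c k))) with (1 / 8) in Hsum by (field; lra).
  exact Hsum.
Qed.

Lemma good_defeats c al om : good c al -> path c al om -> defeats_all_forecasters om.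
Proof.
  intros Hg HP f fv Hf Hv. destruct (forecast_class f fv om Hf Hv) as (i & Hc & Hcl).
  pose proof (fun b => constructive_indefinite_description _ (selection_rule_exists c i b)) as D.
  set (d := fun b => proj1_sig (D b)).
  assert (forall b, computable_selection (d b)) as Hd by (intro b; apply (proj2_sig (D b))).
  pose proof (fun b => rule_on_path c al om i b (d b) Hg HP Hc (proj2 (proj2_sig (D b)))) as Hr.
  set (dv := fun b n => match d b (prefix om n) with Some v => v | None => false end).
  assert (forall b n, d b (prefix om n) = Some (dv b n)) as Hdv.
  { intros b n. unfold dv. destruct (Hr b) as [Hn _]. specialize (Hn n).
    now destruct (d b (prefix om n)). }
  set (err := fun b n => Rabs (/ INR (S n) *
    sum_f_R0 (fun j => b2R (dv b j) * (b2R (om j) - fv j)) n)).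
  assert (forall N, exists n b, (N <= n)%nat /\ 1 / 8 <= err b n) as Hinf.
  { intro N. destruct (infinitely_many_diagonal c al om i Hg HP Hc N) as (k & p & Hk & Hdg).
    destruct (diagonal_error c i om fv k p dv Hcl Hdg) as [b Hb].
    - intros b m Hm. destruct (Hr b) as [_ Hr2]. specialize (Hr2 k p m Hdg Hm).
      rewrite Hdv in Hr2. now injection Hr2.
    (* [err b n] averages over [n + 1] terms, hence the predecessor. *)
    - pose proof (start_gt c (S k)) as HN. exists (pred (start c (S k))), b. split; [lia|].
      unfold err. rewrite sum_f_R0_rsum, Nat.succ_pred by lia. exact Hb. }
  (* The better bit may vary from block to block, but one of the two occurs infinitely often. *)
  assert (exists b, forall N, exists n, (N <= n)%nat /\ 1 / 8 <= err b n) as [b Hb].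
  { apply NNPP. intro Hn.
    assert (forall b, exists N, forall n, (N <= n)%nat -> ~ 1 / 8 <= err b n) as HN.
    { intro b. apply NNPP. intro H. apply Hn. exists b. intro N. apply NNPP. intro H'. apply H.
      exists N. intros n HNn Hle. apply H'. eauto. }
    destruct (HN true) as [N1 H1], (HN false) as [N0 H0].
    destruct (Hinf (max N1 N0)) as (n & [|] & Hn' & Hle).
    - apply (H1 n); [lia|exact Hle].
    - apply (H0 n); [lia|exact Hle]. }
  exists (d b), (dv b). repeat split; auto. intros eta Heta N. destruct (Hb N) as (n & Hn & Hle).
  exists n. split; [exact Hn|]. unfold err in Hle. lra.
Qed.

Theorem theorem2 :
  forall eps : R, 0 < eps ->
  exists Fh : list bool -> list bool -> Prop,
    computable_operation Fh /\
    outer_measure_le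
      (fun alpha => ~ exists om : seqb,
          op_output_inf Fh alpha om /\ defeats_all_forecasters om)
      eps.
Proof.
  intros eps Heps.
  destruct (pow_lt_1_zero (/ 2) ltac:(rewrite Rabs_right; lra) (eps / 3) ltac:(lra)) as [c0 Hc0].
  (* The successor provides [1 <= c], as [good_likely] requires. *)
  set (c := S c0). exists (Fhat c). split; [apply Fhat_operation|].
  apply (outer_measure_le_mono _ (fun al => ~ good c al) (3 * (/ 2) ^ c)).
  - intros al Hal Hg. apply Hal. destruct (path_exists c al (proj1 Hg)) as [om HP].
    exists om. split; [now apply path_output|now apply (good_defeats c al)].
  - specialize (Hc0 c ltac:(unfold c; lia)). rewrite Rabs_right in Hc0; [lra|].
    apply Rle_ge, pow_le. lra.
  - apply good_likely. unfold c. lia.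
Qed.
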